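(* Given a fibration of $\mathbb R^n$ by pairwise skew oriented affine $k$-planes, there exists a $(k+1)$-dimensional (affine) plane in $\mathbb R^n$ transverse to all fibers.
   Context: A fibration of $\mathbb R^n$ by oriented affine $k$-planes is a family of pairwise disjoint oriented affine $k$-planes covering $\mathbb R^n$ such that the map sending $x\in\mathbb R^n$ to the fiber through $x$ (an element of the oriented affine Grassmannian) is continuous. It is skew if no two distinct fibers contain parallel lines. Two affine subspaces of $\mathbb R^n$ are called transverse if their linear translates (the parallel linear subspaces through $0$) intersect only in the origin; their dimensions need not be complementary. *)

(* Defs.v *)
From HB Require Import structures.
From mathcomp Require Import all_boot all_order all_algebra.
From mathcomp Require Import all_classical all_reals all_analysis.
Set Implicit Arguments. Unset Strict Implicit. Unset Printing Implicit Defensive.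
Import Order.TTheory GRing.Theory Num.Theory.
Import numFieldTopology.Exports.
Local Open Scope ring_scope.

(* Points of R^n are row vectors 'rV[R]_n.  A linear k-subspace is given by
   a frame M : 'M[R]_(k,n) (rows = basis vectors, [row_free M]); its direction
   space is the row space of M.  An (oriented) affine k-plane is described by
   a base point [p] and a frame [M]; the associated point set is
   [aff_plane p M] and its orientation is the normalized Plücker vector
   [uplucker M] (the unit k-vector e_1 /\ ... /\ e_k of the frame, written in
   coordinates indexed by all k-tuples of indices). *)

Section Defs.
Variable R : realType.
Variables k n : nat.

Definition aff_plane (p : 'rV[R]_n) (M : 'M[R]_(k, n)) : set 'rV[R]_n :=
  [set y | (y - p <= M)%MS].

Definition plucker (M : 'M[R]_(k, n)) (s : {ffun 'I_k -> 'I_n}) : R :=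
  \det (\matrix_(i < k, j < k) M i (s j)).

Definition plucker_norm (M : 'M[R]_(k, n)) : R :=
  Num.sqrt (\sum_(s : {ffun 'I_k -> 'I_n}) plucker M s ^+ 2).

Definition uplucker (M : 'M[R]_(k, n)) (s : {ffun 'I_k -> 'I_n}) : R :=
  plucker M s / plucker_norm M.

Definition transverse_dirs m1 m2 (A : 'M[R]_(m1, n)) (B : 'M[R]_(m2, n)) :=
  forall v : 'rV[R]_n, (v <= A)%MS -> (v <= B)%MS -> v = 0.

(* A fibration of R^n by oriented affine k-planes, given by the fiber map
   x |-> fiber through x, where the fiber through x is the oriented affine
   plane with base point [a x] (chosen as the foot point: orthogonal to the
   direction space, which makes it canonical) and frame [F x].
   Continuity into the oriented affine Grassmannian is continuity of the
   canonical coordinates (foot point, unit Plücker vector). *)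
Definition oriented_affine_fibration
    (a : 'rV[R]_n -> 'rV[R]_n) (F : 'rV[R]_n -> 'M[R]_(k, n)) : Prop :=
  [/\ (forall x, row_free (F x) /\ a x *m (F x)^T = 0),
      (forall x, aff_plane (a x) (F x) x),
      (forall x y, (aff_plane (a x) (F x) = aff_plane (a y) (F y) /\
                    uplucker (F x) = uplucker (F y))
                   \/ (aff_plane (a x) (F x) `&` aff_plane (a y) (F y) = set0)%classic),
      continuous a &
      (forall s, continuous (fun x => uplucker (F x) s))].

Definition skew_fibration
    (a : 'rV[R]_n -> 'rV[R]_n) (F : 'rV[R]_n -> 'M[R]_(k, n)) : Prop :=
  forall x y, aff_plane (a x) (F x) <> aff_plane (a y) (F y) ->
    transverse_dirs (F x) (F y).

End Defs.

(* Main.v *)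
(* Let F x be the direction and a x the foot of the fiber through x.  The feet
   are unbounded: if |a| were maximal at p, a Brouwer argument on a transversal
   of the fiber of p would produce a nearby fiber whose foot is further out.
   Take fibers whose feet tend to infinity; the linear spans of F x and a x
   accumulate at a (k+1)-dimensional subspace H.  If H met F p in u <> 0, then
   far away fibers would pass projectively close to the point at infinity u of
   the fiber of p.  But, again by Brouwer, the fibers near that of p cover a
   neighbourhood of u in projective space: projected along F p, the map that
   sends a base point x to the defect of the fiber of x at u is homotopic to
   the identity on a small sphere around p through nowhere zero maps, by
   disjointness and skewness.  So a far away fiber would coincide with one near
   the fiber of p, whose foot is bounded.
   Brouwer's theorem is obtained from Scarf's lemma on finite families of
   orders; continuity of orthogonal projectors in the Pluecker coordinates from
   the Cauchy-Binet formula. *)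
Require Import Defs.
From mathcomp Require Import all_boot zify.

(** * Scarf's lemma *)

Section Scarf.
Local Open Scope set_scope.

(** Exactly one fiber of [f] on [S] has two elements, and only these two can be removed without
    losing a value. Applied below to minima of orders and to colours. *)
Lemma card_surplus (A B : finType) (f : A -> B) (S : {set A}) (T : {set B}) :
  #|S| = #|T|.+1 -> f @: S = T ->
  #|[set a in S | f @: (S :\ a) == T]| = 2.
Proof.
move=> cS fS.
have /dinjectivePn [i iS [j /andP[ji jS] fij]] : ~~ dinjectiveb f (mem S).
  by apply/negP => /dinjectiveP /card_in_imset; rewrite fS cS => /n_Sn.
have drop a b : a \in S -> b \in S -> a != b -> f a = f b -> f @: (S :\ a) = T.
  move=> aS bS ab fab; rewrite -fS; apply/eqP; rewrite eqEsubset imsetS ?subD1set //=.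
  apply/subsetP => _ /imsetP[s sS ->]; have [->|sa] := eqVneq s a.
    by rewrite fab imset_f // !inE eq_sym ab.
  by rewrite imset_f // !inE sa.
rewrite -[RHS](_ : #|[set i; j]| = 2); last by rewrite cards2 eq_sym ji.
apply: eq_card => l; rewrite !inE; apply/andP/orP.
  case=> lS /eqP fl; have [_|li] := eqVneq l i; first by left.
  have [_|lj] := eqVneq l j; first by right.
  (* As [j] still supplies the value of [i], both [l] and [i] could go, leaving fewer elements than
     values. *)
  have : f @: (S :\ l :\ i) = T.
    rewrite -fl; apply/eqP; rewrite eqEsubset imsetS ?subD1set //=.
    apply/subsetP => _ /imsetP[s sS ->]; have [->|sa] := eqVneq s i.
      by rewrite fij imset_f // !inE ji jS eq_sym lj.
    by rewrite imset_f // in_setD1 sa.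
  move=> fT; have := leq_imset_card f (S :\ l :\ i); rewrite fT.
  have := cardsD1 l S; rewrite lS cS add1n => -[->].
  by have := cardsD1 i (S :\ l); rewrite !inE eq_sym li iS /= => ->; rewrite add1n ltnn.
case=> /eqP ->; first by rewrite iS (drop i j) // eq_sym.
by rewrite jS (drop j i).
Qed.

Lemma sum_pred_card (T : finType) (P Q : pred T) :
  \sum_(x | P x) Q x = #|[set x | P x && Q x]|.
Proof. by rewrite -sum1dep_card big_mkcondr. Qed.

(* Each [i : N] orders [X] totally through the ranking [rk i]. *)
Variables (X N : finType) (rk : N -> X -> nat).
Hypothesis rk_inj : forall i, injective (rk i).

Definition below (x : X) (S : {set X}) (i : N) := [forall s in S, rk i x <= rk i s].
(** Scarf's dominance: no [x] lies above the minimum of [S] in all orders of [C] at once. *)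
Definition dominant (S : {set X}) (C : {set N}) := [forall x, exists i in C, below x S i].

Lemma belowP x (S : {set X}) i : reflect (forall s, s \in S -> rk i x <= rk i s) (below x S i).
Proof. exact: forall_inP. Qed.

Lemma dominantP (S : {set X}) (C : {set N}) :
  reflect (forall x, exists2 i, i \in C & below x S i) (dominant S C).
Proof. by apply: (iffP forallP) => H x; apply/exists_inP/H. Qed.

Lemma belowS x (S T : {set X}) i : S \subset T -> below x T i -> below x S i.
Proof. by move=> /subsetP ST /belowP H; apply/belowP => s /ST /H. Qed.

Lemma dominantS (S T : {set X}) (C D : {set N}) :
  S \subset T -> C \subset D -> dominant T C -> dominant S D.
Proof.
move=> ST /subsetP CD /dominantP H; apply/dominantP => x.
by have [i /CD iD /(belowS _ _ _ _ ST)] := H x; exists i.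
Qed.

Lemma below_uniq (S : {set X}) i x y :
  x \in S -> y \in S -> below x S i -> below y S i -> x = y.
Proof.
move=> xS yS /belowP /(_ _ yS) xy /belowP /(_ _ xS) yx.
by apply: (rk_inj i); apply/eqP; rewrite eqn_leq xy.
Qed.

(** An order has at most one minimum on [T], so choosing an order for each point is injective. *)
Lemma card_mins (T : {set X}) (C : {set N}) :
  {in T, forall t, exists2 l, l \in C & below t T l} -> #|T| <= #|C|.
Proof.
move=> H; have [->|[t0 t0T]] := set_0Vmem T; first by rewrite cards0.
have [l0 _ _] := H _ t0T.
pose g t := odflt l0 [pick l in C | below t T l].
have gP t : t \in T -> g t \in C /\ below t T (g t).
  move=> tT; rewrite /g; case: pickP => /= [l /andP[]//|].
  by have [l lC lb] := H _ tT; move/(_ l); rewrite lC lb.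
rewrite -(card_in_imset (f := g) (D := mem T)).
  by apply/subset_leq_card/subsetP => _ /imsetP[t /gP[? _] ->].
move=> s t /= sT tT gst; have [_ bs] := gP _ sT; have [_ bt] := gP _ tT.
by apply: below_uniq sT tT bs _; rewrite gst.
Qed.

(** Among dominant pairs, a door has one index more than points and a cell has equally many. [adj]
    joins a door to the cells reached by adding a point or dropping an index. *)
Definition adj (d e : {set X} * {set N}) :=
  [exists x, (x \notin d.1) && (e == (x |: d.1, d.2))]
  || [exists i, (i \in d.2) && (e == (d.1, d.2 :\ i))].

Section Door.
Variables (S : {set X}) (C : {set N}).
Hypotheses (dSC : dominant S C) (cSC : #|C| = #|S|.+1).

(** The orders that can be given up while every point of [S] stays minimal in a remaining one. They
    turn out to be in bijection with the cells adjacent to the door. *)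
Definition free_index :=
  [set i in C | [forall s in S, exists l in C :\ i, below s S l]].
Definition undominated i := [set x | ~~ [exists l in C :\ i, below x S l]].
(** Scarf's pivot. Giving up order [i] uncovers exactly the points of [undominated i]: if there are
    none, [i] is dropped, otherwise the largest of them in order [i] joins [S]. *)
Definition neighbour i :=
  if [pick x in undominated i | [forall y in undominated i, rk i y <= rk i x]]
  is Some x then (x |: S, C) else (S, C :\ i).

Lemma free_indexP i : reflect (i \in C /\ forall s, s \in S ->
  exists2 l, l \in C :\ i & below s S l) (i \in free_index).
Proof.
rewrite inE; apply: (iffP andP) => -[-> H]; split => //.
  by move=> s sS; apply/exists_inP; apply: (forall_inP H).
by apply/forall_inP => s sS; apply/exists_inP/H.
Qed.

Lemma undominatedP i x :
  reflect (forall l, l \in C -> l != i -> ~~ below x S l) (x \in undominated i).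
Proof.
rewrite inE; apply: (iffP idP) => [/exists_inP H l lC li|H].
  by apply/negP => bl; apply: H; exists l; rewrite // !inE li.
by apply/exists_inP => -[l]; rewrite !inE => /andP[li lC]; apply/negP/H.
Qed.

Lemma neighbourP i :
  (exists x, [/\ x \in undominated i, {in undominated i, forall y, rk i y <= rk i x}
    & neighbour i = (x |: S, C)])
  \/ undominated i = set0 /\ neighbour i = (S, C :\ i).
Proof.
rewrite /neighbour; case: pickP => /= [x /andP[xu /forall_inP mx]|H]; first by left; exists x.
right; split=> //; apply/eqP; apply: contraT => /set0Pn [x0 x0u].
have := H [arg max_(x > x0 in undominated i) rk i x].
case: arg_maxnP => //= x xu mx; rewrite xu /=.
by move/negbT/forall_inPn => [y yu]; rewrite mx.
Qed.

Lemma adj_free_index e :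
  dominant e.1 e.2 -> adj (S, C) e -> exists2 i, i \in free_index & e = neighbour i.
Proof.
case: e => T D /= domTD /orP[/existsP[x /= /andP[xS /eqP[eT eD]]]|
                            /existsP[i /= /andP[iC /eqP[eT eD]]]]; subst T D.
  have xxS : x \in x |: S by rewrite !inE eqxx.
  have cxS : #|x |: S| = #|C| by rewrite cardsU1 xS cSC.
  have mins t : t \in x |: S -> exists2 l, l \in C & below t (x |: S) l.
    by move=> _; have /dominantP := domTD; apply.
  have [i iC bi] := mins x xxS.
  (* The points of [x |: S] are minima of distinct orders and use up all of [C]. If [x] were minimal
     in [l] too, the orders other than [l] would suffice. *)
  have nx l : l \in C -> l != i -> ~~ below x (x |: S) l.
    move=> lC li; apply/negP => bl.
    have : #|x |: S| <= #|C :\ l|.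
      apply: card_mins => t tS; have [m mC bm] := mins t tS.
      have [ml|ml] := eqVneq m l; last by exists m; rewrite // !inE ml.
      exists i; first by rewrite !inE eq_sym li.
      by rewrite (below_uniq (x |: S) l t x) // -ml.
    by rewrite cxS (cardsD1 l C) lC add1n ltnn.
  have xu : x \in undominated i.
    apply/undominatedP => l lC li; have := nx l lC li; apply: contra => /belowP H.
    by apply/belowP => s; rewrite !inE => /orP[/eqP->//|/H].
  have mx y : y \in undominated i -> rk i y <= rk i x.
    move=> /undominatedP yu; have /dominantP/(_ y) [l lC bl] := domTD.
    have [li|li] := eqVneq l i; first by rewrite -li; move/belowP: bl; apply.
    by have := yu l lC li; rewrite (belowS _ _ _ _ (subsetUr _ _) bl).
  exists i.
    apply/free_indexP; split=> // s sS.
    have sxS : s \in x |: S by rewrite !inE sS orbT.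
    have [l lC bl] := mins s sxS.
    exists l; last exact: belowS (subsetUr _ _) bl.
    rewrite !inE lC andbT; apply: contraNneq xS => li.
    by rewrite (below_uniq (x |: S) i x s) // -li.
  have [[z [zu mz ->]]|[u0 _]] := neighbourP i; last by rewrite u0 inE in xu.
  by congr (_ |: _, _); apply: (rk_inj i); apply/eqP; rewrite eqn_leq mx // mz.
exists i.
  by apply/free_indexP; split => // s sS; have /dominantP := domTD; apply.
have [[z [/undominatedP zu mz _]]|[u0 ->//]] := neighbourP i.
have /dominantP/(_ z) [l] := domTD; rewrite !inE => /andP[li lC] bl.
by have := zu l lC li; rewrite bl.
Qed.

Lemma neighbour_notin i x : i \in free_index -> x \in undominated i -> x \notin S.
Proof.
move=> /free_indexP[iC H] /undominatedP xu; apply/negP => /H [l].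
by rewrite !inE => /andP[li lC]; apply/negP/xu.
Qed.

Lemma neighbour_adj i : i \in free_index ->
  [/\ dominant (neighbour i).1 (neighbour i).2, adj (S, C) (neighbour i)
    & #|(neighbour i).1| = #|(neighbour i).2|].
Proof.
move=> fi; have /free_indexP[iC H] := fi.
have [[x [xu mx ->]]|[u0 ->]] /= := neighbourP i.
  have xS := neighbour_notin i x fi xu; split.
  - apply/dominantP => y; have [yu|] := boolP (y \in undominated i).
      have /dominantP/(_ y) [l lC bl] := dSC; exists i => //.
      have li : l = i.
        by apply/eqP; apply: contraLR bl => li; move/undominatedP: yu => /(_ l lC li).
      apply/belowP => s; rewrite !inE => /orP[/eqP->|]; first exact: mx.
      by rewrite -li; move/belowP: bl; apply.
    rewrite inE negbK => /exists_inP[l lCi bl].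
    have /andP[li lC] : (l != i) && (l \in C) by move: lCi; rewrite !inE.
    (* As [x] is undominated, some point of [S] is smaller than [x] in order [l]; so [y], being
       below [S], is also below [x]. *)
    exists l => //; move/undominatedP: xu => /(_ l lC li) /forall_inPn[s sS].
    rewrite -ltnNge => sx.
    apply/belowP => t; rewrite !inE => /orP[/eqP->|]; last by move/belowP: bl; apply.
    by move/belowP: bl => /(_ _ sS) /leq_trans; apply; exact: ltnW.
  - by apply/orP; left; apply/existsP; exists x => /=; rewrite xS eqxx.
  - by rewrite cardsU1 xS cSC.
split.
- apply/dominantP => y; apply/exists_inP; have : y \notin undominated i by rewrite u0 inE.
  by rewrite inE negbK.
- by apply/orP; right; apply/existsP; exists i => /=; rewrite iC eqxx.
- by have := cardsD1 i C; rewrite iC cSC => -[].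
Qed.

Lemma neighbour_inj : {in free_index &, injective neighbour}.
Proof.
move=> i j fi fj; have /free_indexP[iC _] := fi; have /free_indexP[jC _] := fj.
have [[x [xu mx ->]]|[u0 ->]] := neighbourP i;
have [[y [yu my ->]]|[v0 ->]] := neighbourP j.
- case=> /setP exy; apply/eqP; apply: contraT => ij.
  have xy : x = y.
    have := exy x; rewrite !inE eqxx (negbTE (neighbour_notin _ _ fi xu)) orbF.
    by rewrite orbF => /esym/eqP.
  (* Being undominated for both [i] and [j], the point [x] would be below [S] in no order of [C]. *)
  have /dominantP/(_ x) [l lC] := dSC; apply: contraTT => _.
  have [li|li] := eqVneq l i; last by move/undominatedP: xu; apply.
  by move/undominatedP: yu; rewrite xy; apply; rewrite // li.
- by case=> _ /setP/(_ j); rewrite !inE eqxx jC.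
- by case=> _ /setP/(_ i); rewrite !inE eqxx iC.
- case=> /setP/(_ i); rewrite !inE eqxx iC !andbT /=.
  by move/esym/negbFE/eqP.
Qed.

Lemma card_adj :
  #|[set e | (dominant e.1 e.2 && (#|e.1| == #|e.2|)) && adj (S, C) e]|
  = #|free_index|.
Proof.
rewrite -(card_in_imset neighbour_inj); apply: eq_card => e; rewrite !inE.
apply/andP/imsetP => [[/andP[de ce] ae]|[i fi ->]].
  by have [i fi ->] := adj_free_index e de ae; exists i.
by have [-> -> ->] := neighbour_adj i fi; rewrite eqxx.
Qed.

(** Send each order of [C] to the minimum of [S] in it. By dominance this map is onto [S]; an order
    is free when the map stays onto without it, and [card_surplus] finds two such orders. Over an
    empty [S] the single order is free. *)
Lemma card_free_index : #|free_index| = if S == set0 then 1 else 2.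
Proof.
have [S0|/set0Pn[s0 s0S]] := eqVneq S set0.
  rewrite -[RHS](_ : #|C| = 1); last by rewrite cSC S0 cards0.
  apply: eq_card => i; rewrite inE S0 andb_idr // => _.
  by apply/forall_inP => s; rewrite inE.
pose f i := [arg min_(s < s0 in S) rk i s].
have fP i : f i \in S /\ below (f i) S i.
  by rewrite /f; case: arg_minnP => // s sS ms; split=> //; apply/belowP.
have fE i s : s \in S -> below s S i -> f i = s.
  by move=> sS bs; have [fS bf] := fP i; exact: below_uniq fS sS bf bs.
rewrite -(card_surplus _ _ f C S) //.
  apply: eq_card => i; rewrite !inE; congr (_ && _).
  apply/forall_inP/eqP => [H|H s sS].
    apply/setP => s; apply/imsetP/idP => [[l _ ->]|sS]; first by have [] := fP l.
    by have /exists_inP[l lC bl] := H s sS; exists l => //; rewrite (fE l s).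
  move: sS; rewrite -H => /imsetP[l lC ->]; rewrite H.
  by apply/exists_inP; exists l => //; have [] := fP l.
apply/setP => s; apply/imsetP/idP => [[l _ ->]|sS]; first by have [] := fP l.
by have /dominantP/(_ s) [l lC bl] := dSC; exists l => //; rewrite (fE l s).
Qed.

End Door.

Variables (c : X -> N) (i0 : N).

Definition coloured_door (d : {set X} * {set N}) :=
  [&& dominant d.1 d.2, #|d.2| == #|d.1|.+1, i0 \in d.2 & c @: d.1 == d.2 :\ i0].

(** An adjacent coloured door arises by removing a point ([U1]) or adding an index ([U2]). Either
    [U1] has two elements and [U2] none, or both have one, or both are empty. *)
Lemma coloured_door_even (S : {set X}) (C : {set N}) :
  dominant S C -> #|S| = #|C| -> c @: S != C ->
  odd #|[set d | coloured_door d && adj d (S, C)]| = false.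
Proof.
move=> dSC cSC ncomplete.
pose U1 := [set x in S | (i0 \in C) && (c @: (S :\ x) == C :\ i0)].
pose U2 := [set i | [&& i \notin C, i0 \in i |: C & c @: S == (i |: C) :\ i0]].
have -> : [set d | coloured_door d && adj d (S, C)] =
   (fun x => (S :\ x, C)) @: U1 :|: (fun i => (S, i |: C)) @: U2.
  apply/setP => -[T D]; rewrite !inE; apply/andP/orP.
    case=> /and4P[/= dT cT iD /eqP cc] /orP[/existsP[x /= /andP[xT /eqP[eS eC]]]|
       /existsP[i /= /andP[iiD /eqP[eS eC]]]]; subst S C.
      left; apply/imsetP; exists x; last by rewrite setU1K.
      by rewrite !inE eqxx iD setU1K //= cc.
    right; apply/imsetP; exists i; last by rewrite setD1K.
    by rewrite inE setD11 /= setD1K // iD cc eqxx.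
  case=> /imsetP.
    case=> x; rewrite !inE => /and3P[xS iC /eqP cx] [-> ->]; split.
      rewrite /coloured_door /= (dominantS (S :\ x) S C C) ?subD1set // iC cx eqxx !andbT.
      by rewrite -cSC (cardsD1 x S) xS add1n eqxx.
    by apply/orP; left; apply/existsP; exists x; rewrite /= !inE eqxx setD1K /=.
  case=> i; rewrite inE => /and3P[iC i0C /eqP ci] [-> ->]; split.
    rewrite /coloured_door /= (dominantS S S C (i |: C)) ?subsetUr // i0C ci eqxx !andbT.
    by rewrite /= cSC cardsU1 iC add1n eqxx.
  by apply/orP; right; apply/existsP; exists i; rewrite /= !inE eqxx setU1K /=.
have -> : #|(fun x => (S :\ x, C)) @: U1 :|: (fun i => (S, i |: C)) @: U2| = #|U1| + #|U2|.
  rewrite cardsU (_ : _ :&: _ = set0) ?cards0 ?subn0.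
    rewrite !card_in_imset //.
      move=> i j; rewrite !inE => /and3P[iC _ _] /and3P[jC _ _] [] /setP/(_ i).
      by rewrite !inE eqxx (negbTE iC) !orbF => /esym/eqP.
    move=> x y; rewrite !inE => /and3P[xS _ _] /and3P[yS _ _] [] /setP/(_ x).
    by rewrite !inE eqxx xS !andbT => /esym/negbFE/eqP.
  apply/setP => d; rewrite !inE; apply/andP => -[/imsetP[x]].
  by rewrite inE => /and3P[xS _ _] -> /imsetP[i _ []] /setP/(_ x); rewrite !inE eqxx xS.
(* Without [i0] in [C], only [i0] could be added, and then the colours of [S] would be exactly
   [C]. *)
have [i0C|i0C] := boolP (i0 \in C); last first.
  have -> : U1 = set0 by apply/setP => x; rewrite !inE (negbTE i0C) andbF.
  suff -> : U2 = set0 by rewrite !cards0.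
  apply/setP => i; rewrite !inE; apply/and3P => -[iC].
  rewrite (negbTE i0C) orbF => /eqP ->.
  by rewrite setU1K // (negbTE ncomplete).
have cC : #|C| = #|C :\ i0|.+1 by rewrite (cardsD1 i0 C) i0C.
(* If the colours are [C :\ i0], one of them occurs twice and either of its points can be
   removed. *)
have [cS|cS] := eqVneq (c @: S) (C :\ i0).
  rewrite (_ : U2 = set0) ?cards0 ?addn0; last first.
    apply/setP => i; rewrite !inE; apply/and3P => -[iC _]; rewrite cS => /eqP/setP/(_ i).
    rewrite !inE (negbTE iC) eqxx !andbT andbF => /esym/negbFE/eqP ei.
    by rewrite -ei (negbTE iC) in i0C.
  rewrite (_ : #|U1| = 2) //.
  rewrite -(card_surplus _ _ c S (C :\ i0)) ?cSC //.
  by apply: eq_card => x; rewrite !inE i0C.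
have [U20|/set0Pn[i]] := eqVneq U2 set0.
  suff -> : U1 = set0 by rewrite U20 !cards0.
  apply/setP => x; rewrite !inE i0C /=.
  apply/andP => -[xS /eqP cx].
  (* The colour of [x] cannot be [i0], which would complete the colours, nor another element of [C],
     by [cS]; outside [C] it would lie in [U2]. *)
  have ecS : c @: S = c x |: (C :\ i0) by rewrite -cx -imsetU1 setD1K.
  have [cxC|cxC] := boolP (c x \in C).
    have [ex|ex] := eqVneq (c x) i0.
      by move: ncomplete; rewrite ecS ex setD1K // eqxx.
    by move: cS; rewrite ecS (setUidPr _) ?eqxx // sub1set !inE ex cxC.
  have : c x \in U2.
    rewrite inE cxC !inE i0C orbT /= ecS; apply/eqP/setP => j; rewrite !inE.
    have [->|//] := eqVneq j (c x).
    by rewrite andbT /=; symmetry; apply: contraNneq cxC => ->.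
  by rewrite U20 inE.
rewrite inE => /and3P[iC _ /eqP ci].
have ii0 : i != i0 by apply: contraNneq iC => ->.
have eci : c @: S = i |: (C :\ i0).
  rewrite ci; apply/setP => j; rewrite !inE.
  by have [->|//] := eqVneq j i; rewrite ii0.
(* The colours on [S] are distinct, so only the point [x] of the extra colour [i] can be removed. *)
have cinj : {in S &, injective c}.
  by apply/imset_injP; rewrite eci cardsU1 !inE (negbTE iC) andbF cSC cC.
have /imsetP[x xS ix] : i \in c @: S by rewrite eci !inE eqxx.
have -> : U2 = [set i].
  apply/setP => y; rewrite !inE; apply/and3P/eqP => [[yC _]|->]; last by rewrite iC i0C orbT ci.
  rewrite eci => /eqP/setP/(_ y); rewrite !inE eqxx (negbTE yC) /= andbF orbF andbT.
  by rewrite (contraNneq _ yC) => [/eqP|->].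
suff -> : U1 = [set x] by rewrite !cards1.
apply/setP => y; rewrite !inE i0C /=; apply/andP/eqP => [[yS /eqP cy]|->].
  apply/eqP; apply: contraT => yx.
  have : c x \in c @: (S :\ y) by rewrite imset_f // !inE eq_sym yx.
  by rewrite cy -ix !inE (negbTE iC) andbF.
split=> //; apply/eqP; rewrite -(setU1K (a := i) (B := C :\ i0)) ?inE ?(negbTE iC) ?andbF //.
rewrite -eci; apply/setP => j; apply/imsetP/idP.
  case=> s; rewrite !inE => /andP[sx sS] ->; rewrite imset_f // andbT.
  by apply: contraNneq sx; rewrite ix => /cinj ->.
rewrite !inE => /andP[ji /imsetP[s sS js]]; exists s => //.
by rewrite !inE sS andbT; apply: contraNneq ji => sx; rewrite js sx -ix.
Qed.

(* Double counting of the pairs (coloured door, adjacent cell): a coloured door is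
   adjacent to two cells, except for the outer one, adjacent to one, and a cell
   with [c @: S <> C] is adjacent to an even number of coloured doors. *)
Theorem scarf (x0 : X) : exists S C,
  [/\ dominant S C, #|S| = #|C| & c @: S = C].
Proof.
pose cell (e : {set X} * {set N}) := dominant e.1 e.2 && (#|e.1| == #|e.2|).
have [/existsP[[S C] /andP[/andP[dSC /eqP cSC] /eqP cc]]|] :=
  boolP [exists e, cell e && (c @: e.1 == e.2)]; first by exists S, C.
rewrite negb_exists => /forallP nocomplete.
have even_cells : odd (\sum_(e | cell e) \sum_(d | coloured_door d) adj d e) = false.
  elim/big_rec: _ => // -[S C] m cellSC IH; rewrite oddD IH addbF sum_pred_card.
  have /andP[/= dSC /eqP cSC] := cellSC.
  rewrite coloured_door_even //.
  by have := nocomplete (S, C); rewrite cellSC.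
have outer : coloured_door (set0, [set i0]).
  rewrite /coloured_door /= cards1 cards0 set11 imset0 setDv !eqxx !andbT.
  by apply/dominantP => x; exists i0; rewrite ?inE //; apply/belowP => s; rewrite inE.
move: even_cells; rewrite exchange_big /= (bigD1 (set0, [set i0])) //=.
have count d : coloured_door d -> \sum_(e | cell e) adj d e = if d.1 == set0 then 1 else 2.
  case: d => S C /and4P[/= dSC /eqP cSC _ _].
  by rewrite -(card_free_index S C) // -(card_adj S C) // sum_pred_card.
rewrite oddD count //.
rewrite eqxx /= (_ : odd _ = false) //.
(* A coloured door without points has a single index, which must be [i0]; so every door other than
   the outer one counts twice. *)
elim/big_rec: _ => // -[S C] m /andP[dSC ne] IH; rewrite oddD IH count //=.
case: eqVneq => // S0; move: dSC ne; rewrite S0 /coloured_door /= cards0.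
case/and4P => _ /cards1P[i ->]; rewrite inE => /eqP ->.
by rewrite eqxx.
Qed.

End Scarf.

(** * Colourings of the barycentric grid of a simplex *)

Section Grid.
Variables (n M : nat).

Definition grid := {t : {ffun 'I_n.+1 -> 'I_M.+1} | \sum_i t i == M}.
Definition grid_coord (t : grid) (i : 'I_n.+1) : nat := val t i.

Lemma sum_grid_coord t : \sum_i grid_coord t i = M.
Proof. exact: (eqP (valP t)). Qed.

Lemma grid_of (h : 'I_n.+1 -> nat) :
  \sum_i h i = M -> exists t, forall i, grid_coord t i = h i.
Proof.
move=> hM; have le i : h i < M.+1 by rewrite ltnS -hM (bigD1 i) //= leq_addr.
pose v := [ffun i => inord (h i) : 'I_M.+1].
have vP : \sum_i v i == M.
  by rewrite -[X in _ == X]hM; apply/eqP/eq_bigr => i _; rewrite ffunE inordK.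
by exists (exist _ v vP) => i; rewrite /grid_coord /= ffunE inordK.
Qed.

(** The tie-break by [enum_rank], smaller than the factor [#|{: grid}|], makes the order by
    coordinate [i] injective. *)
Definition grid_rank i (t : grid) := grid_coord t i * #|{: grid}| + enum_rank t.

Lemma coord_grid_rank i s t : grid_coord t i < grid_coord s i -> grid_rank i t < grid_rank i s.
Proof.
move=> lt; apply: (@leq_trans ((grid_coord t i).+1 * #|{: grid}|)).
  by rewrite /grid_rank mulSn addnC ltn_add2r ltn_ord.
by apply: leq_trans (leq_addr _ _); rewrite leq_mul2r lt orbT.
Qed.

Lemma grid_rank_inj i : injective (grid_rank i).
Proof.
move=> s t /eqP e; apply/eqP; move: e; apply: contraTT => st.
have [lt|lt|est] := ltngtP (grid_coord s i) (grid_coord t i).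
- by rewrite neq_ltn coord_grid_rank.
- rewrite neq_ltn; rewrite [X in _ || X]coord_grid_rank ?orbT //.
by rewrite /grid_rank est eqn_add2l; apply: contra st => /eqP/val_inj/enum_rank_inj ->.
Qed.

(** Scarf's lemma for the coordinate orders gives [S] and [C]. Dominance forces the minima over [S]
    of the coordinates in [C] to add up to almost [M], so the points of [S] are close to each other
    and their coordinates outside [C] are small. Every [i] in [C] is the colour of a point of
    [S]. *)
Lemma grid_colouring (c : grid -> 'I_n.+1) : exists s0, forall i,
  grid_coord s0 i <= n.+1 \/ exists2 s, c s = i &
    forall j, grid_coord s j <= grid_coord s0 j + n.+1 /\ grid_coord s0 j <= grid_coord s j + n.+1.
Proof.
have [x0 _] : exists t, forall i, grid_coord t i = if i == ord0 then M else 0.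
  by apply: grid_of; rewrite -big_mkcond big_pred1_eq.
have [S [C [dSC cSC cc]]] := scarf _ _ grid_rank grid_rank_inj c ord0 x0.
have [i1 i1C _] := dominantP _ _ _ _ _ dSC x0.
have [s0 s0S] : exists s, s \in S.
  by apply/set0Pn; rewrite -cards_eq0 cSC cards_eq0; apply/set0Pn; exists i1.
pose a i := [arg min_(s < s0 in S) grid_coord s i].
have aP i : a i \in S /\ forall s, s \in S -> grid_coord (a i) i <= grid_coord s i.
  by rewrite /a; case: arg_minnP.
pose mn i := grid_coord (a i) i.
(* Otherwise some grid point exceeds every minimum over [C], the surplus being put into coordinate
   [i1], against dominance. *)
have claim : M < \sum_(i in C) (mn i).+1.
  rewrite ltnNge; apply/negP => le.
  have [t tE] : exists t, forall i, grid_coord t i =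
    if i \in C then (mn i).+1 + (if i == i1 then M - \sum_(i in C) (mn i).+1 else 0) else 0.
    apply: grid_of; rewrite -big_mkcond big_split /= [X in _ + X](bigD1 i1) //= eqxx.
    rewrite [X in _ + (_ + X)]big1 ?addn0 ?subnKC // => i /andP[_ /negbTE ->] //.
  have [i iC /belowP] := dominantP _ _ _ _ _ dSC t.
  have [aS _] := aP i; move/(_ _ aS); apply/negP; rewrite -ltnNge.
  by apply: coord_grid_rank; rewrite tE iC leq_addr.
have {}claim : M < \sum_(i in C) mn i + n.+1.
  apply: leq_trans claim _; under eq_bigr do rewrite -addn1.
  by rewrite big_split /= leq_add2l sum1_card -[leqRHS]card_ord max_card.
have inC s j : s \in S -> j \in C -> mn j <= grid_coord s j < mn j + n.+1.
  move=> sS jC; have [_ /(_ s sS) ->] := aP j; rewrite /=.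
  have : \sum_(i in C) grid_coord s i <= M.
    by rewrite -(sum_grid_coord s) [leqRHS](bigID (mem C)) leq_addr.
  have : \sum_(i in C | i != j) mn i <= \sum_(i in C | i != j) grid_coord s i.
    by apply: leq_sum => i _; have [_] := aP i; apply.
  move: claim; rewrite !(bigD1 (P := mem C) j) //=; lia.
have notinC s j : s \in S -> j \notin C -> grid_coord s j < n.+1.
  move=> sS jC.
  have : grid_coord s j + \sum_(i in C) grid_coord s i <= M.
    rewrite -(sum_grid_coord s) [leqRHS](bigID (mem C)) addnC leq_add2l /=.
    by rewrite (bigD1 j) //= leq_addr.
  have : \sum_(i in C) mn i <= \sum_(i in C) grid_coord s i.
    by apply: leq_sum => i _; have [_] := aP i; apply.
  lia.
exists s0 => i; have [|iC] := boolP (i \in C); last by left; have := notinC s0 i s0S iC; lia.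
rewrite -cc => /imsetP[s sS ->]; right; exists s => // j.
have [jC|jC] := boolP (j \in C).
  have := inC s j sS jC; have := inC s0 j s0S jC; lia.
have := notinC s j sS jC; have := notinC s0 j s0S jC; lia.
Qed.
End Grid.

Arguments grid_coord {n M} t i.
Arguments sum_grid_coord {n M} t.

(* Imported only here because [classical_sets] shadows the [finset] names used above. *)
From HB Require Import structures.
From mathcomp Require Import all_boot all_order all_algebra.
From mathcomp Require Import fingroup perm.
From mathcomp Require Import all_classical all_reals all_analysis.
From mathcomp Require Import ring lra.
Import Order.TTheory GRing.Theory Num.Theory.
Import numFieldTopology.Exports.
Import numFieldNormedType.Exports.
Set Implicit Arguments. Unset Strict Implicit. Unset Printing Implicit Defensive.
Local Open Scope ring_scope.

(** * Brouwer's theorem *)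

Section MatrixContinuity.
Context {R : realType} {T : topologicalType}.
Local Open Scope classical_set_scope.

Lemma mx_norm_lt m n (A : 'M[R]_(m, n)) (e : R) :
  0 < e -> (`|A| < e) <-> (forall i j, `|A i j| < e).
Proof.
move=> e0; rewrite [`|A|]mx_normrE; split.
  by move=> /bigmax_ltP[_ H] i j; exact: (H (i, j)).
by move=> H; apply/bigmax_ltP; split=> // -[i j] _; exact: H.
Qed.

Lemma mx_norm_le m n (A : 'M[R]_(m, n)) (e : R) :
  0 <= e -> (`|A| <= e) <-> (forall i j, `|A i j| <= e).
Proof.
move=> e0; rewrite [`|A|]mx_normrE; split.
  by move=> /bigmax_leP[_ H] i j; exact: (H (i, j)).
by move=> H; apply/bigmax_leP; split=> // -[i j] _; exact: H.
Qed.

Lemma mx_entry_le m n (A : 'M[R]_(m, n)) i j : `|A i j| <= `|A|.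
Proof. by move: i j; apply/mx_norm_le. Qed.

Lemma continuous_mx m n (f : T -> 'M[R]_(m, n)) :
  (forall i j, continuous (fun x => f x i j)) -> continuous f.
Proof.
move=> cf x; apply/cvgrPdist_lt => e e0.
have H : \forall y \near x, forall ij : 'I_m * 'I_n, `|f x ij.1 ij.2 - f y ij.1 ij.2| < e.
  by apply: filter_forall => -[i j]; have /cvgrPdist_lt := cf i j x; apply.
apply: filterS H => y H; apply/mx_norm_lt => // i j; rewrite !mxE.
exact: (H (i, j)).
Qed.

Lemma continuous_entry m n (f : T -> 'M[R]_(m, n)) i j :
  continuous f -> continuous (fun x => f x i j).
Proof.
move=> cf x.
exact: (@continuous_comp _ _ _ f (fun M : 'M[R]_(m, n) => M i j) x (cf x)
  (@coord_continuous _ _ _ i j (f x))).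
Qed.

Lemma continuous_sum (I : Type) (r : seq I) (P : pred I) (f : I -> T -> R) :
  (forall i, continuous (f i)) -> continuous (fun x => \sum_(i <- r | P i) f i x).
Proof.
move=> cf; elim: r => [|i r IH].
  by under eq_fun do rewrite big_nil; exact: cst_continuous.
under eq_fun do rewrite big_cons.
case: (P i) => // x; exact: (continuousD (cf i x) (IH x)).
Qed.

Lemma continuous_mulmx m n p (f : T -> 'M[R]_(m, n)) (g : T -> 'M[R]_(n, p)) :
  continuous f -> continuous g -> continuous (fun x => f x *m g x).
Proof.
move=> cf cg; apply: continuous_mx => i j.
under eq_fun do rewrite mxE.
apply: continuous_sum => k x.
by apply: continuousM; exact: continuous_entry.
Qed.

End MatrixContinuity.

(** * Barycentric coordinates and almost fixed points *)

Section Brouwer.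
Context {R : realType} {n : nat}.
Local Open Scope classical_set_scope.

Definition bary (x : 'rV[R]_n) (i : 'I_n.+1) : R :=
  if unlift ord0 i is Some j then x 0 j else 1 - \sum_j x 0 j.

Definition simplex : set 'rV[R]_n := [set x | forall i, 0 <= bary x i].

Lemma bary_lift x j : bary x (lift ord0 j) = x 0 j.
Proof. by rewrite /bary liftK. Qed.

Lemma bary0 x : bary x ord0 = 1 - \sum_j x 0 j.
Proof. by rewrite /bary unlift_none. Qed.

Lemma sum_bary x : \sum_i bary x i = 1.
Proof.
rewrite big_ord_recl bary0 -[RHS](subrK (\sum_j x 0 j)); congr (_ + _).
by apply: eq_bigr => j _; exact: bary_lift.
Qed.

Lemma bary_continuous i : continuous (bary^~ i).
Proof.
rewrite /bary; case: (unlift _ i) => [j|] /=; first exact: coord_continuous.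
move=> x; apply: (continuousB (@cst_continuous _ _ _ x)).
exact: (@continuous_sum R _ _ (index_enum _) xpredT
  (fun j (v : 'rV[R]_n) => v 0 j) (fun j => @coord_continuous R 1 n 0 j)).
Qed.

Lemma bary_inj x y : (forall i, bary x i = bary y i) -> x = y.
Proof. by move=> H; apply/rowP => j; rewrite -!bary_lift. Qed.

(** Both sides sum to 1, so no inequality can be strict. *)
Lemma le_bary_le x y : (forall i, bary x i <= bary y i) -> x = y.
Proof.
move=> H; apply: bary_inj => i; apply/eqP; rewrite eq_le H /=.
rewrite -subr_le0 -(addrN (\sum_i bary y i)) {2}sum_bary -(sum_bary x) -sumrB.
by rewrite (bigD1 i) //= lerDl sumr_ge0 // => j _; rewrite subr_ge0.
Qed.

Lemma simplex_bounded x : simplex x -> `|x| <= 1.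
Proof.
move=> sx; apply/mx_norm_le => // i j; rewrite (ord1 i) -bary_lift.
rewrite ger0_norm // -(sum_bary x) (bigD1 (lift ord0 j)) //= lerDl.
by apply: sumr_ge0 => k _; exact: sx.
Qed.

Lemma simplex_compact : compact simplex.
Proof.
apply: bounded_closed_compact.
  by exists 1; split => // M M1 x /simplex_bounded /le_trans; apply; exact: ltW.
rewrite (_ : simplex = \bigcap_(i in setT) (bary^~ i @^-1` [set t | 0 <= t])).
  apply: closed_bigI => i _; apply: preimage_closed; last exact: closed_ge.
  by move=> x _; exact: bary_continuous.
by apply/seteqP; split => x /= sx i; [move=> _; exact: sx|exact: sx].
Qed.

Variable f : 'rV[R]_n -> 'rV[R]_n.

(* For small [e] this approximates the condition that [bary y <= bary (f y)] on
   the support of [y], which forces [f y = y] since barycentric coordinates sum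
   to 1. *)
Definition almost_fixed (e : R) (y : 'rV[R]_n) :=
  forall i, bary y i <= e \/
    exists z, `|z - y| <= e /\ bary z i <= bary (f z) i.

(** Without fixed points, near each [y] some barycentric coordinate strictly drops under [f], which
    excludes almost fixed points there once the error is small. Compactness makes this uniform in
    [y]. *)
Lemma fixed_point_of_almost : continuous f ->
  (forall y, simplex y -> simplex (f y)) ->
  (forall m, exists2 y, simplex y & almost_fixed (n.+1%:R / m.+1%:R) y) ->
  exists x, f x = x.
Proof.
move=> cf sf H; apply: contrapT => /forallNP nofix.
have /compact_near_coveringP/(_ nat \oo
  (fun m y => ~ almost_fixed (n.+1%:R / m.+1%:R) y) _) := simplex_compact.
case.
  move=> y sy.
  have [i fi] : exists i, bary (f y) i < bary y i.
    apply: contrapT => /forallNP ge; apply: (nofix y); apply/esym/le_bary_le => i.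
    by rewrite leNgt; apply/negP/ge.
  have pos : 0 < bary y i by apply: le_lt_trans fi; exact: (sf y sy).
  have near1 : \forall z \near y, bary (f z) i < bary z i.
    have : {for y, continuous (fun z => bary z i - bary (f z) i)}.
      apply: continuousB; first exact: bary_continuous.
      by apply: (@continuous_comp _ _ _ f (bary^~ i)); [exact: cf|exact: bary_continuous].
    move=> /(@cvgr_gt _ _ _ _ _ _) /(_ 0); rewrite subr_gt0 => /(_ fi).
    by apply: filterS => z; rewrite subr_gt0.
  have near2 : \forall z \near y, bary y i / 2 < bary z i.
    apply: (cvgr_gt _ (@bary_continuous i y)); lra.
  have /nbhs_normP[d /= d0 dP] : \forall z \near y,
      bary (f z) i < bary z i /\ bary y i / 2 < bary z i.
    by apply: filterI.
  (* Half the radius, so that a witness close to [z] is still close to [y]; half of [bary y i], so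
     that the first alternative of [almost_fixed] fails. *)
  have nearm : \forall m \near \oo, n.+1%:R / m.+1%:R < Num.min (d / 2) (bary y i / 2).
    have e0 : 0 < Num.min (d / 2) (bary y i / 2) by rewrite lt_min; apply/andP; split; lra.
    have := nbhs_infty_gtr (n.+1%:R / Num.min (d / 2) (bary y i / 2)).
    apply: filterS => m; rewrite ltr_pdivrMr // ltr_pdivrMr ?ltr0n // => /lt_trans; apply.
    by rewrite mulrC ltr_pM2l // ltr_nat.
  have neary : \forall z \near y, `|y - z| < d / 2.
    by apply/nbhs_normP; exists (d / 2) => //=; lra.
  near=> z m => /= /(_ i).
  have zy : `|y - z| < d / 2 by near: z.
  have : n.+1%:R / m.+1%:R < Num.min (d / 2) (bary y i / 2) by near: m.
  rewrite lt_min; set e := (n.+1%:R / m.+1%:R) => /andP[md mb].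
  have [_ bz] : bary (f z) i < bary z i /\ bary y i / 2 < bary z i by apply: dP => /=; lra.
  case; first lra.
  case=> w [wz]; rewrite leNgt => /negP; apply.
  suff [] : bary (f w) i < bary w i /\ bary y i / 2 < bary w i by [].
  apply: dP => /=; rewrite -(subrK z y) -addrA; apply: le_lt_trans (ler_normD _ _) _.
  rewrite (distrC z w); lra.
move=> m _ /(_ m (leqnn _)) Hm; have [y sy ay] := H m; exact: Hm sy ay.
Unshelve. all: by end_near. Qed.

End Brouwer.

(** * Brouwer's theorem for the simplex and for bounded maps *)

Section BrouwerTheorem.
Context {R : realType} {n : nat}.
Local Open Scope classical_set_scope.

Definition grid_point m (t : grid n m) : 'rV[R]_n :=
  \row_j ((grid_coord t (lift ord0 j))%:R / m%:R).

Lemma bary_grid_point m (t : grid n m.+1) i :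
  bary (grid_point t) i = (grid_coord t i)%:R / m.+1%:R.
Proof.
case: (unliftP ord0 i) => [j ->|->]; first by rewrite bary_lift mxE.
have m0 : m.+1%:R != 0 :> R by rewrite pnatr_eq0.
rewrite bary0; apply: (mulIf m0); rewrite divfK // mulrBl mul1r mulr_suml.
rewrite (eq_bigr (fun j => (grid_coord t (lift ord0 j))%:R)) => [|j _]; last first.
  by rewrite mxE divfK.
rewrite -natr_sum -natrB; last first.
  by rewrite -[leqRHS](sum_grid_coord t) big_ord_recl leq_addl.
by rewrite -[X in (X - _)%N](sum_grid_coord t) big_ord_recl addnK.
Qed.

Lemma grid_point_simplex m (t : grid n m.+1) : simplex (grid_point t).
Proof. by move=> i; rewrite bary_grid_point divr_ge0. Qed.

(** The colour of a grid point is a barycentric coordinate that [f] does not decrease; one exists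
    because the coordinates sum to 1. *)
Lemma brouwer_simplex (f : 'rV[R]_n -> 'rV[R]_n) : continuous f ->
  (forall y, simplex y -> simplex (f y)) -> exists x, f x = x.
Proof.
move=> cf sf; apply: fixed_point_of_almost => // m.
pose c (t : grid n m.+1) := odflt ord0
  [pick i | bary (grid_point t) i <= bary (f (grid_point t)) i].
have cP t : bary (grid_point t) (c t) <= bary (f (grid_point t)) (c t).
  rewrite /c; case: pickP => //= H.
  have lt : f (grid_point t) = grid_point t.
    by apply: le_bary_le => i; rewrite ltW // ltNge H.
  by have := H ord0; rewrite lt lexx.
have [s0 s0P] := grid_colouring _ _ c.
exists (grid_point s0) => [|i]; first exact: grid_point_simplex.
have [le|[s cs near]] := s0P i.
  by left; rewrite bary_grid_point ler_pM2r ?invr_gt0 ?ltr0n // ler_nat.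
right; exists (grid_point s); split; last by rewrite -cs; exact: cP.
apply/mx_norm_le => [|k j]; first by rewrite divr_ge0.
rewrite (ord1 k) !mxE -mulrBl normrM normfV [`|m.+1%:R|]ger0_norm //.
rewrite ler_pM2r ?invr_gt0 ?ltr0n // ler_norml.
have [le1 le2] := near (lift ord0 j).
have : (grid_coord s (lift ord0 j))%:R <= (grid_coord s0 (lift ord0 j))%:R + n.+1%:R :> R.
  by rewrite -natrD ler_nat.
have : (grid_coord s0 (lift ord0 j))%:R <= (grid_coord s (lift ord0 j))%:R + n.+1%:R :> R.
  by rewrite -natrD ler_nat.
by move=> h1 h2; apply/andP; split; lra.
Qed.

(** The affine map [L] carries the simplex onto one that contains the cube in which [f] takes its
    values. *)
Lemma brouwer_bounded (f : 'rV[R]_n -> 'rV[R]_n) (r : R) : continuous f ->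
  (forall x, `|f x| <= r) -> exists x, f x = x.
Proof.
move=> cf fr; pose q : R := Num.max r 1; have q0 : 0 < q by rewrite lt_max ltr01 orbT.
have fq x i j : `|f x i j| <= q.
  move: i j; apply/mx_norm_le; first exact: ltW.
  by rewrite (le_trans (fr x)) // le_max lexx.
(* A cube of side [2 * q] fits into the simplex of size [d]; [n.+1] instead of [n] keeps [d]
   positive in dimension 0. *)
pose d : R := 2 * q * n.+1%:R; have d0 : 0 < d by rewrite !mulr_gt0.
pose L (y : 'rV[R]_n) : 'rV[R]_n := d *: y - const_mx q.
pose g y : 'rV[R]_n := d^-1 *: (f (L y) + const_mx q).
have [|y _ |y gy] := brouwer_simplex (f := g).
- have cL : continuous L.
    move=> y; apply: continuousB; last exact: cst_continuous.
    apply: (@continuousZ _ _ _ (cst d) id); first exact: cst_continuous.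
    by move=> A.
  move=> y; apply: (@continuousZ _ _ _ (cst d^-1) (fun y => f (L y) + const_mx q)).
    exact: cst_continuous.
  apply: continuousD; last exact: cst_continuous.
  by apply: (@continuous_comp _ _ _ L f); [exact: cL | exact: cf].
- move=> i; case: (unliftP ord0 i) => [j ->|->].
    rewrite bary_lift !mxE mulr_ge0 ?invr_ge0 ?(ltW d0) //.
    by have := fq (L y) 0 j; rewrite ler_norml => /andP[]; lra.
  rewrite bary0 subr_ge0.
  apply: (@le_trans _ _ (\sum_(j < n) d^-1 * (2 * q))).
    apply: ler_sum => j _; rewrite !mxE ler_pM2l ?invr_gt0 //.
    by have := fq (L y) 0 j; rewrite ler_norml => /andP[]; lra.
  rewrite sumr_const card_ord -[leLHS]mulr_natr -mulrA ler_pdivrMl // mulr1.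
  by rewrite /d ler_pM2l ?mulr_gt0 // ler_nat.
exists (L y); rewrite -{2}gy /L /g scalerA divff ?gt_eqF // scale1r.
by rewrite addrK.
Qed.

End BrouwerTheorem.

Section ContinuityRules.
Local Open Scope classical_set_scope.
Context {R : realType}.

Lemma continuous_compose (S T U : topologicalType) (f : S -> T) (g : T -> U) :
  continuous f -> continuous g -> continuous (fun x => g (f x)).
Proof. by move=> cf cg x; apply: (@continuous_comp _ _ _ f g x); [exact: cf|exact: cg]. Qed.

Lemma continuous_pair (S T U : topologicalType) (f : S -> T) (g : S -> U) :
  continuous f -> continuous g -> continuous (fun x => (f x, g x)).
Proof. by move=> cf cg x; apply: cvg_pair; [exact: cf|exact: cg]. Qed.

Lemma continuous_add (T : topologicalType) (V : normedModType R) (f g : T -> V) :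
  continuous f -> continuous g -> continuous (fun x => f x + g x).
Proof. by move=> cf cg x; apply: continuousD; [exact: cf|exact: cg]. Qed.

Lemma continuous_sub (T : topologicalType) (V : normedModType R) (f g : T -> V) :
  continuous f -> continuous g -> continuous (fun x => f x - g x).
Proof. by move=> cf cg x; apply: continuousB; [exact: cf|exact: cg]. Qed.

Lemma continuous_scale (T : topologicalType) (V : normedModType R) (s : T -> R) (f : T -> V) :
  continuous s -> continuous f -> continuous (fun x => s x *: f x).
Proof. by move=> cs cf x; apply: continuousZ; [exact: cs|exact: cf]. Qed.

Lemma continuous_mul (T : topologicalType) (f g : T -> R) :
  continuous f -> continuous g -> continuous (fun x => f x * g x).
Proof. by move=> cf cg x; apply: continuousM; [exact: cf|exact: cg]. Qed.

Lemma continuous_norm (T : topologicalType) (V : normedModType R) (f : T -> V) :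
  continuous f -> continuous (fun x => `|f x|).
Proof. by move=> cf x; apply: cvg_norm; exact: cf. Qed.

Lemma continuous_const (S T : topologicalType) (c : T) : continuous (fun _ : S => c).
Proof. exact: cst_continuous. Qed.

Lemma continuous_fst (S T : topologicalType) : continuous (@fst S T).
Proof. by move=> x; exact: cvg_fst. Qed.

Lemma continuous_snd (S T : topologicalType) : continuous (@snd S T).
Proof. by move=> x; exact: cvg_snd. Qed.

Lemma continuous_idfun (S : topologicalType) : continuous (fun x : S => x).
Proof. by move=> x A. Qed.

End ContinuityRules.

(** * Zeros that persist under perturbation *)

Section Degree.
Local Open Scope classical_set_scope.
Context {R : realType} {n : nat}.

(* Brouwer applied to [y - g y] pushed radially onto the ball. *)
Lemma brouwer_zero (g : 'rV[R]_n -> 'rV[R]_n) (r : R) : 0 < r -> continuous g ->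
  exists2 y, `|y| <= r & g y = 0 \/ `|y| = r /\ exists2 t, 0 < t & g y = - t *: y.
Proof.
move=> r0 cg; pose z y := y - g y.
pose f y := (r / Num.max r `|z y|) *: z y.
have m0 y : 0 < Num.max r `|z y| by rewrite lt_max r0.
have cz : continuous z by apply: continuous_sub => //; exact: continuous_idfun.
have cf : continuous f.
  apply: continuous_scale => // y.
  apply: (@continuousM _ _ (cst r) (fun y => (Num.max r `|z y|)^-1)).
    exact: cst_continuous.
  apply: continuousV; first by rewrite gt_eqF.
  apply: (@continuous_max R _ (cst r) (fun y => `|z y|)); first exact: cst_continuous.
  exact: continuous_norm.
have [|y fy] := brouwer_bounded (f := f) (r := r) cf.
  move=> y; rewrite normrZ (ger0_norm (divr_ge0 (ltW r0) (ltW (m0 y)))) mulrAC ler_pdivrMr //.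
  by rewrite ler_pM2l // le_max lexx orbT.
have [zr|zr] := leP `|z y| r.
  have zy : z y = y by rewrite -[RHS]fy /f max_l // divff ?gt_eqF // scale1r.
  exists y; first by rewrite -zy.
  by left; rewrite -(subKr y (g y)) -/(z y) zy subrr.
have z0 : 0 < `|z y| by exact: lt_trans zr.
have yE : (r / `|z y|) *: z y = y by rewrite -[RHS]fy /f max_r // ltW.
have yr : `|y| = r by rewrite -yE normrZ ger0_norm ?divr_ge0 ?ltW // divfK ?gt_eqF.
exists y; rewrite ?yr //; right; split=> //; exists (`|z y| / r - 1).
  by rewrite subr_gt0 ltr_pdivlMr // mul1r.
have zE : (`|z y| / r) *: y = z y.
  rewrite -[X in _ *: X]yE scalerA mulrA divfK ?gt_eqF // divff ?gt_eqF //.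
  by rewrite scale1r.
by rewrite opprB scalerBl scale1r zE /z subKr.
Qed.

Lemma sphere_compact (r : R) : compact [set y : 'rV[R]_n | `|y| = r].
Proof.
apply: bounded_closed_compact.
  by exists r; split; rewrite ?num_real // => M rM y /= ->; exact: ltW.
apply: (@preimage_closed _ _ (fun y : 'rV[R]_n => `|y|) [set t | t = r]).
  by move=> y _; exact: norm_continuous.
exact: closed_eq.
Qed.

(* The condition at [i0] makes the map [y |-> h (i0, p + y) *m (1 - P) + y *m P]
   homotopic to the identity on the sphere through nowhere zero maps. *)
Lemma hit_stable (I : topologicalType) (i0 : I) (h : I * 'rV[R]_n -> 'rV[R]_n)
    (P : 'M[R]_n) (p : 'rV[R]_n) (r : R) :
  0 < r -> continuous h -> P *m P = P ->
  (forall y t, `|y| = r -> y *m P = 0 -> 0 <= t ->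
     (h (i0, p + y) + t *: y) *m (1%:M - P) <> 0) ->
  \forall i \near i0, exists2 y, `|y| <= r & h (i, p + y) *m (1%:M - P) = 0.
Proof.
move=> r0 ch PP H.
pose g i y : 'rV[R]_n := h (i, p + y) *m (1%:M - P) + y *m P.
pose G (w : ('rV[R]_n * R) * I) := (1 - w.1.2) *: g w.2 w.1.1 + w.1.2 *: w.1.1.
have QP : (1%:M - P) *m P = 0 by rewrite mulmxBl mul1mx PP subrr.
have PQ : P *m (1%:M - P) = 0 by rewrite mulmxBr mulmx1 PP subrr.
have cg (T : topologicalType) (a : T -> I) (b : T -> 'rV[R]_n) :
    continuous a -> continuous b -> continuous (fun x => g (a x) (b x)).
  move=> ca cb; apply: continuous_add; apply: continuous_mulmx => //; try exact: continuous_const.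
  apply: (@continuous_compose _ _ _ (fun x => (a x, p + b x)) h) => //.
  by apply: continuous_pair => //; apply: continuous_add => //; exact: continuous_const.
have c1 : continuous (fun w : ('rV[R]_n * R) * I => w.1.1).
  by apply: (@continuous_compose _ _ _ fst fst); exact: continuous_fst.
have c2 : continuous (fun w : ('rV[R]_n * R) * I => w.1.2).
  by apply: (@continuous_compose _ _ _ fst snd); [exact: continuous_fst|exact: continuous_snd].
have c3 : continuous (fun w : ('rV[R]_n * R) * I => w.2) by exact: continuous_snd.
have cG : continuous G.
  apply: continuous_add; last exact: continuous_scale.
  apply: continuous_scale; last exact: cg.
  by apply: (@continuous_sub _ _ R^o) => //; exact: continuous_const.
pose K : set ('rV[R]_n * R) := [set y | `|y| = r] `*` `[0, 1]%classic.
have cK : compact K.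
  by apply: compact_setX; [exact: sphere_compact|exact: segment_compact].
(* [G] is the straight homotopy from [g i] to the identity. At [i0] it has no zero on the sphere,
   and by compactness none for nearby [i]. *)
have : \forall i \near i0, K `<=` [set w | G (w, i) != 0].
  have /compact_near_coveringP/(_ I (nbhs i0) (fun i w => G (w, i) != 0) _) := cK.
  apply.
  move=> [y l] /= [/= yr]; rewrite in_itv /= => /andP[l0 l1].
  suff G0 : G ((y, l), i0) != 0 by exact: (cvgr_neq0 _ (cG _) G0).
  apply/eqP; rewrite /G /= => G0.
  (* Multiplication by [P] turns [G] into [y *m P] for every [l]. So [y *m P = 0] at a zero, and [H]
     applies with [t = l / (1 - l)]. *)
  have yP : y *m P = 0.
    have := congr1 (mulmx^~ P) G0; rewrite mul0mx mulmxDl -!scalemxAl mulmxDl.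
    by rewrite -!mulmxA QP PP mulmx0 add0r -scalerDl subrK scale1r.
  have yQ : y *m (1%:M - P) = y by rewrite mulmxBr mulmx1 yP subr0.
  have := congr1 (mulmx^~ (1%:M - P)) G0; rewrite mul0mx /g yP addr0 mulmxDl -!scalemxAl.
  rewrite -mulmxA (_ : (1%:M - P) *m (1%:M - P) = 1%:M - P); last first.
    by rewrite mulmxBl PQ subr0 mul1mx.
  move=> eq0; have [l1'|l1'] := eqVneq l 1.
    move: eq0; rewrite l1' subrr scale0r add0r scale1r yQ => y0.
    by move: r0; rewrite -yr y0 normr0 ltxx.
  have l10 : 0 < 1 - l by rewrite subr_gt0 lt_neqAle l1' l1.
  apply: (H y (l / (1 - l))) => //; first by rewrite divr_ge0 // ltW.
  rewrite mulmxDl -scalemxAl; apply: (@scalerI _ _ (1 - l)); first by rewrite gt_eqF.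
  by rewrite scaler0 scalerDr scalerA mulrC divfK ?gt_eqF.
apply: filterS => i HU.
have [|y yr] := @brouwer_zero (g i) r r0.
  by apply: cg; [exact: continuous_const|exact: continuous_idfun].
case=> [gy|[yr' [t t0 gy]]].
  exists y => //; have := congr1 (mulmx^~ P) gy.
  rewrite mul0mx mulmxDl -!mulmxA QP PP mulmx0 add0r => yP.
  by move: gy; rewrite /g yP addr0.
have t1 : 0 < 1 + t by rewrite addr_gt0.
(* At this time the segment from [- t *: y] to [y] passes through 0. *)
have /HU/eqP : K (y, t / (1 + t)).
  split=> //=; rewrite in_itv /= divr_ge0 ?(ltW t0) ?(ltW t1) //=.
  by rewrite ler_pdivrMr // mul1r lerDr.
case; rewrite /G /= gy scalerA -scalerDl -[RHS](scale0r y); congr (_ *: _).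
by field; rewrite gt_eqF.
Qed.

End Degree.

(** * Orthogonal projectors from Pluecker coordinates *)

Section CauchyBinet.
Variables (R : comNzRingType) (m n : nat).

Definition minor (A : 'M[R]_(m, n)) (s : {ffun 'I_m -> 'I_n}) : R :=
  \det (\matrix_(i < m, j < m) A i (s j)).

(** The sum runs over all tuples of columns, so each set of [m] columns is counted once per
    ordering; hence the factorial. *)
Lemma cauchy_binet (A B : 'M[R]_(m, n)) :
  \sum_s minor A s * minor B s = m`!%:R * \det (A *m B^T).
Proof.
have expandA (s : {ffun 'I_m -> 'I_n}) : minor A s * minor B s =
    \sum_(p : 'S_m) (-1) ^+ p * (\prod_i A i (s (p i))) * minor B s.
  rewrite [X in X * _]/minor /determinant mulr_suml; apply: eq_bigr => p _.
  by congr (_ * _ * _); apply: eq_bigr => i _; rewrite mxE.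
rewrite (eq_bigr _ (fun s _ => expandA s)) exchange_big /=.
(* Reindexing the tuples by [p] moves the permutation into [minor B], whose sign cancels that of
   [p]. *)
have perm_term (p : 'S_m) : \sum_(s : {ffun 'I_m -> 'I_n})
      (-1) ^+ p * (\prod_i A i (s (p i))) * minor B s =
    \sum_(s : {ffun 'I_m -> 'I_n}) (\prod_i A i (s i)) * minor B s.
  pose h (s : {ffun 'I_m -> 'I_n}) := [ffun i => s ((p^-1)%g i)].
  have hK : bijective h.
    exists (fun s : {ffun 'I_m -> 'I_n} => [ffun i => s (p i)]) => s; apply/ffunP => i.
      by rewrite !ffunE permK.
    by rewrite !ffunE permKV.
  rewrite (reindex h) /=; last exact: onW_bij.
  apply: eq_bigr => s _.
  have -> : \prod_i A i (h s (p i)) = \prod_i A i (s i).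
    by apply: eq_bigr => i _; rewrite ffunE permK.
  have -> : minor B (h s) = (-1) ^+ p * minor B s.
    rewrite /minor -det_perm mulrC -det_mulmx -{1}(invgK p) -col_permE; congr (\det _).
    by apply/matrixP => i j; rewrite !mxE ffunE.
  set e := (-1) ^+ p; have ee : e * e = 1 by rewrite /e -expr2 sqrr_sign.
  set a := \prod_i _; set b := minor B s.
  have -> : e * a * (e * b) = (e * e) * (a * b) by ring.
  by rewrite ee mul1r.
rewrite (eq_bigr _ (fun p _ => perm_term p)) sumr_const card_Sn -[LHS]mulr_natl.
congr (_ * _).
rewrite [RHS]/determinant.
have expandB (s : {ffun 'I_m -> 'I_n}) : (\prod_i A i (s i)) * minor B s =
    \sum_(p : 'S_m) (-1) ^+ p * \prod_i (A i (s i) * B (p i) (s i)).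
  rewrite /minor -det_tr mulr_sumr; apply: eq_bigr => p _; rewrite mulrCA big_split /=.
  by congr (_ * (_ * _)); apply: eq_bigr => i _; rewrite !mxE.
rewrite (eq_bigr _ (fun s _ => expandB s)) exchange_big /=.
apply: eq_bigr => p _; rewrite -mulr_sumr; congr (_ * _).
rewrite -(bigA_distr_bigA (fun i c => A i c * B (p i) c)).
by apply: eq_bigr => i _; rewrite !mxE; apply: eq_bigr => c _; rewrite mxE.
Qed.
End CauchyBinet.

(** * The projector as a polynomial in the unit Pluecker coordinates *)

Section Projector.
Variables (R : realType).

Definition gram k n (M : 'M[R]_(k, n)) := M *m M^T.
(** The orthogonal projector onto the row space of [M], acting on row vectors from the right. *)
Definition proj k n (M : 'M[R]_(k, n)) : 'M[R]_n := M^T *m invmx (gram M) *m M.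

Lemma dotv_eq0 n (v : 'rV[R]_n) : (v *m v^T) 0 0 = 0 -> v = 0.
Proof.
rewrite mxE => /eqP; rewrite psumr_eq0 => [|i _]; last by rewrite !mxE -expr2 sqr_ge0.
move=> /allP H; apply/rowP => j; rewrite mxE; apply/eqP.
by have := H j; rewrite mem_index_enum mxE -expr2 sqrf_eq0 => /(_ isT).
Qed.

(** If [v] is in the kernel of the Gram matrix, then [v *m M] has length 0. *)
Lemma gram_unit k n (M : 'M[R]_(k, n)) : row_free M -> gram M \in unitmx.
Proof.
move=> fM; rewrite -row_free_unit -kermx_eq0; apply/eqP/row_matrixP => i.
rewrite row0; set v := row i _.
have vG : v *m gram M = 0 by apply: sub_kermxP; exact: row_sub.
have : v *m M = 0.
  by apply: dotv_eq0; rewrite trmx_mul mulmxA -(mulmxA v) vG mul0mx mxE.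
by move=> vM; apply: (row_free_inj fM); rewrite mul0mx.
Qed.

Section Basics.
Variables (k n : nat) (M : 'M[R]_(k, n)).
Hypothesis fM : row_free M.

Lemma mul_proj : M *m proj M = M.
Proof. by rewrite /proj !mulmxA mulmxV ?gram_unit // mul1mx. Qed.

Lemma proj_idem : proj M *m proj M = proj M.
Proof. by rewrite {1}/proj -mulmxA mul_proj. Qed.

Lemma proj_tr : (proj M)^T = proj M.
Proof. by rewrite /proj !trmx_mul trmxK trmx_inv trmx_mul trmxK mulmxA. Qed.

Lemma proj_sub m (A : 'M[R]_(m, n)) : (A *m proj M <= M)%MS.
Proof. by rewrite /proj mulmxA submxMl. Qed.

Lemma sub_projE (v : 'rV[R]_n) : (v <= M)%MS = (v *m proj M == v).
Proof.
apply/idP/eqP => [/submxP[D ->]|<-]; first by rewrite -mulmxA mul_proj.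
exact: proj_sub.
Qed.

Lemma proj_trace : \tr (proj M) = k%:R.
Proof. by rewrite /proj -mulmxA mxtrace_mulC -mulmxA mulVmx ?gram_unit ?mxtrace1. Qed.

(** The second factor is the Schur complement of the Gram block. *)
Lemma det_gram_bordered (v w : 'rV[R]_n) :
  \det (col_mx v M *m (col_mx w M)^T) =
  \det (gram M) * (v *m (1%:M - proj M) *m w^T) 0 0.
Proof.
rewrite tr_col_mx mul_col_row.
set b := v *m M^T; set c := M *m w^T; set G := gram M.
have -> : block_mx (v *m w^T) b c (M *m M^T) =
  block_mx 1%:M (b *m invmx G) 0 1%:M *m
  block_mx (v *m w^T - b *m invmx G *m c) 0 c G.
  rewrite mulmx_block !mul1mx !mul0mx !add0r subrK.
  by rewrite mulmxKV ?gram_unit.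
rewrite det_mulmx det_ublock !det1 mul1r mul1r det_lblock mulrC; congr (_ * _).
rewrite det_mx11; congr (fun_of_matrix _ _ _).
by rewrite mulmxBr mulmxBl mulmx1 /proj !mulmxA.
Qed.

(* Laplace expansion along the first row. *)
Definition wedge (u : {ffun 'I_k -> 'I_n} -> R) (t : {ffun 'I_k.+1 -> 'I_n}) (a : 'I_n) : R :=
  \sum_j (t j == a)%:R * ((-1) ^+ j * u [ffun i => t (lift j i)]).

Lemma minor_wedge (t : {ffun 'I_k.+1 -> 'I_n}) (a : 'I_n) :
  minor (col_mx (delta_mx 0 a) M : 'M[R]_(1 + k, n)) t = wedge (plucker M) t a.
Proof.
rewrite /minor (expand_det_row _ ord0); apply: eq_bigr => j _.
rewrite mxE; congr (_ * _).
  have e0 : lshift k (ord0 : 'I_1) = ord0 :> 'I_(1 + k) by exact: val_inj.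
  have := @col_mxEu R 1 k n (delta_mx 0 a) M ord0 (t j); rewrite e0 => ->.
  by rewrite mxE eqxx eq_sym.
rewrite /cofactor add0n; congr (_ * \det _).
apply/matrixP => i l; rewrite [RHS]mxE ffunE.
transitivity ((col_mx (delta_mx 0 a) M : 'M[R]_(1 + k, n)) (lift ord0 i) (t (lift j l))).
  by rewrite !mxE.
have e1 : rshift 1 i = lift ord0 i :> 'I_(1 + k) by exact: val_inj.
by have := @col_mxEd R 1 k n (delta_mx 0 a) M i (t (lift j l)); rewrite e1 => ->.
Qed.

Lemma plucker_norm_sqr : plucker_norm M ^+ 2 = k`!%:R * \det (gram M).
Proof.
rewrite /plucker_norm sqr_sqrtr ?sumr_ge0 // => [|s _]; last exact: sqr_ge0.
by rewrite -cauchy_binet; apply: eq_bigr => s _; rewrite expr2.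
Qed.

Lemma plucker_norm_neq0 : plucker_norm M != 0.
Proof.
rewrite -sqrf_eq0 plucker_norm_sqr mulf_neq0 ?pnatr_eq0 -?lt0n ?fact_gt0 //.
by have := gram_unit fM; rewrite unitmxE unitfE.
Qed.

(** Cauchy-Binet for the frame extended by the basis vectors [a] and [b]: by [det_gram_bordered] the
    determinant contains the entry of the complementary projector, and [k.+1] is the quotient of the
    two factorials. *)
Lemma projE a b : proj M a b = (a == b)%:R -
  k.+1%:R^-1 * \sum_t wedge (uplucker M) t a * wedge (uplucker M) t b.
Proof.
have wE t c : wedge (plucker M) t c = plucker_norm M * wedge (uplucker M) t c.
  rewrite mulr_sumr; apply: eq_bigr => j _.
  rewrite [RHS]mulrCA [X in _ = _ * X]mulrCA; congr (_ * (_ * _)).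
  by rewrite /uplucker mulrCA divff ?plucker_norm_neq0 ?mulr1.
have := cauchy_binet (col_mx (delta_mx 0 a) M : 'M[R]_(1 + k, n)) (col_mx (delta_mx 0 b) M).
rewrite det_gram_bordered.
rewrite (eq_bigr (fun t => plucker_norm M ^+ 2 *
   (wedge (uplucker M) t a * wedge (uplucker M) t b))) => [|t _]; last first.
  by rewrite !minor_wedge !wE mulrACA -expr2.
rewrite -mulr_sumr plucker_norm_sqr factS natrM.
set S := \sum_t _.
have -> : (delta_mx 0 a *m (1%:M - proj M) *m (delta_mx 0 b)^T : 'M[R]_1) 0 0 =
    (a == b)%:R - proj M a b.
  by rewrite trmx_delta -rowE -colE !mxE.
have d0 : \det (gram M) != 0 by have := gram_unit fM; rewrite unitmxE unitfE.
have f0 : k`!%:R != 0 :> R by rewrite pnatr_eq0 -lt0n fact_gt0.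
have k0 : k.+1%:R != 0 :> R by rewrite pnatr_eq0.
move: d0 f0 k0; set d := \det _; set f := k`!%:R; set c := k.+1%:R => d0 f0 c0 H.
have {}H : S = c * ((a == b)%:R - proj M a b).
  by apply: (mulfI (mulf_neq0 f0 d0)); rewrite H; ring.
by rewrite H mulKf // opprB addrC subrK.
Qed.


End Basics.

Lemma proj_continuous k n (T : topologicalType) (F : T -> 'M[R]_(k, n)) :
  (forall x, row_free (F x)) ->
  (forall s, continuous (fun x => uplucker (F x) s)) ->
  continuous (fun x => proj (F x)).
Proof.
move=> fF cF; apply: continuous_mx => a b.
under eq_fun do rewrite projE //.
have cW t c : continuous (fun x => wedge (uplucker (F x)) t c).
  apply: continuous_sum => j; apply: continuous_mul; first exact: continuous_const.
  by apply: continuous_mul; [exact: continuous_const | exact: cF].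
apply: (@continuous_sub R _ R^o); first exact: continuous_const.
apply: continuous_mul; first exact: continuous_const.
by apply: continuous_sum => t; apply: continuous_mul.
Qed.

(** With [Q] factored through its rank, the factors in the other order multiply to the identity. The
    trace is continuous, so this keeps the rank of idempotents in a limit. *)
Lemma rank_idem n (Q : 'M[R]_n) : Q *m Q = Q -> (\rank Q)%:R = \tr Q.
Proof.
move=> QQ; have bb : row_base Q *m col_base Q = 1%:M.
  apply: (row_full_inj (col_base_full Q)); apply: (row_free_inj (row_base_free Q)).
  by rewrite mulmx1 mulmxA -mulmxA !mulmx_base QQ.
by rewrite -[in RHS](mulmx_base Q) mxtrace_mulC bb mxtrace1.
Qed.

Lemma idem_basis n m (Q : 'M[R]_n) : Q *m Q = Q -> \tr Q = m%:R ->
  exists H : 'M[R]_(m, n), row_free H /\ (H <= Q)%MS.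
Proof.
move=> QQ trQ; have <- : \rank Q = m by apply/eqP; rewrite -(eqr_nat R) rank_idem // trQ.
by exists (row_base Q); rewrite row_base_free eq_row_base.
Qed.
End Projector.

(** * Skew fibrations *)

Section Dot.
Context {R : realType} {n : nat}.
Implicit Types u v w : 'rV[R]_n.

Definition dot u v : R := (u *m v^T) 0 0.

Lemma dotE u v : dot u v = \sum_i u 0 i * v 0 i.
Proof. by rewrite /dot mxE; apply: eq_bigr => i _; rewrite mxE. Qed.

Lemma dotC u v : dot u v = dot v u.
Proof. by rewrite !dotE; apply: eq_bigr => i _; rewrite mulrC. Qed.

Lemma dotDl u v w : dot (u + v) w = dot u w + dot v w.
Proof. by rewrite /dot mulmxDl mxE. Qed.

Lemma dotZl c u v : dot (c *: u) v = c * dot u v.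
Proof. by rewrite /dot -scalemxAl mxE. Qed.

Lemma dotNl u v : dot (- u) v = - dot u v.
Proof. by rewrite -scaleN1r dotZl mulN1r. Qed.

Lemma dotDr u v w : dot w (u + v) = dot w u + dot w v.
Proof. by rewrite dotC dotDl !(dotC w). Qed.

Lemma dotZr c u v : dot u (c *: v) = c * dot u v.
Proof. by rewrite dotC dotZl dotC. Qed.

Lemma dot_ge0 u : 0 <= dot u u.
Proof. by rewrite dotE sumr_ge0 // => i _; rewrite -expr2 sqr_ge0. Qed.

Lemma dot_gt0 u : u != 0 -> 0 < dot u u.
Proof.
move=> u0; rewrite lt_neqAle dot_ge0 andbT eq_sym; apply: contraNneq u0 => /dotv_eq0 ->.
by [].
Qed.

Lemma dot_mulmx u v (A : 'M[R]_n) : dot (u *m A) v = dot u (v *m A^T).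
Proof. by rewrite /dot trmx_mul trmxK mulmxA. Qed.

(** The norm here is the largest absolute value of an entry; this bound and [norm_dot_le] compare it
    with the Euclidean product. *)
Lemma norm_sqr_le_dot u : `|u| ^+ 2 <= dot u u.
Proof.
rewrite -[leRHS]sqr_sqrtr ?dot_ge0 // ler_pXn2r ?nnegrE ?sqrtr_ge0 //.
apply/mx_norm_le => [|i j]; first exact: sqrtr_ge0.
rewrite (ord1 i) -sqrtr_sqr ler_wsqrtr // dotE (bigD1 j) //= expr2 lerDl.
by rewrite sumr_ge0 // => l _; rewrite -expr2 sqr_ge0.
Qed.

Lemma norm_dot_le u v : `|dot u v| <= n%:R * (`|u| * `|v|).
Proof.
rewrite dotE; apply: le_trans (ler_norm_sum _ _ _) _.
rewrite mulr_natl -[X in _ *+ X]card_ord -sumr_const; apply: ler_sum => i _.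
by rewrite normrM; apply: ler_pM => //; exact: mx_entry_le.
Qed.

End Dot.

(** * Feet, linear spans and the transverse plane *)

Section Fibration.
Variables (R : realType) (k n : nat).
Hypothesis lt_kn : (k < n)%N.
Variables (a : 'rV[R]_n -> 'rV[R]_n) (F : 'rV[R]_n -> 'M[R]_(k, n)).
Hypothesis fib : oriented_affine_fibration a F.
Hypothesis skew : skew_fibration a F.
Local Open Scope classical_set_scope.

Let P x := proj (F x).

Lemma F_free x : row_free (F x). Proof. by case: fib => /(_ x)[]. Qed.
Hint Resolve F_free : core.

Lemma foot_perp x : a x *m P x = 0.
Proof. by case: fib => /(_ x)[_ aF] _ _ _ _; rewrite /P /proj !mulmxA aF !mul0mx. Qed.

Lemma foot_sub x : (x - a x <= F x)%MS.
Proof. by case: fib => _ /(_ x). Qed.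

Lemma a_continuous : continuous a. Proof. by case: fib. Qed.

Lemma P_continuous : continuous P.
Proof. by case: fib => _ _ _ _ cF; exact: proj_continuous. Qed.

Definition same_fiber x y := aff_plane (a x) (F x) = aff_plane (a y) (F y).

Lemma same_fiberP x y z : (z - x <= F x)%MS -> (z - y <= F y)%MS -> same_fiber x y.
Proof.
move=> zx zy; case: fib => _ _ /(_ x y) [[//]|H] _ _; exfalso.
have : (aff_plane (a x) (F x) `&` aff_plane (a y) (F y)) z.
  by split; rewrite /aff_plane /=; [rewrite -(subrK x z)|rewrite -(subrK y z)];
    rewrite -addrA addmx_sub ?foot_sub.
by rewrite H.
Qed.

Lemma same_fiber_sub x y : same_fiber x y -> (x - y <= F y)%MS.
Proof.
move=> e; have : aff_plane (a y) (F y) x by rewrite -e; exact: foot_sub.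
rewrite /aff_plane /= => xy; rewrite -(subrK (a y) x) -addrA addmx_sub //.
by rewrite -opprB eqmx_opp foot_sub.
Qed.

(** The difference of the feet is a direction of both planes, hence orthogonal to both feet and to
    itself. *)
Lemma same_fiber_foot x y : same_fiber x y -> a x = a y.
Proof.
move=> e; have ax : (a x - a y <= F y)%MS.
  have : aff_plane (a y) (F y) (a x) by rewrite -e /aff_plane /= subrr sub0mx.
  by [].
have ay : (a y - a x <= F x)%MS.
  have : aff_plane (a x) (F x) (a y) by rewrite e /aff_plane /= subrr sub0mx.
  by [].
have perp z v : (v <= F z)%MS -> dot (a z) v = 0.
  rewrite sub_projE // => /eqP <-; rewrite -[proj _]proj_tr -dot_mulmx foot_perp.
  by rewrite /dot mul0mx mxE.
apply/eqP; rewrite -subr_eq0; apply/eqP/dotv_eq0; rewrite -/(dot _ _).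
rewrite dotDl (perp x) ?add0r; last by rewrite -opprB eqmx_opp.
by rewrite dotNl (perp y) ?oppr0.
Qed.

Lemma same_fiber_perp p y : same_fiber (p + y) p -> y *m P p = 0 -> y = 0.
Proof.
move=> /same_fiber_sub; rewrite addrC addKr sub_projE // => /eqP yP.
by rewrite -/(P p) in yP; rewrite yP.
Qed.

(** The point [x + t^-1 *: f] lies on both fibers. This turns a failure of the hypothesis of
    [hit_stable] into a coincidence of fibers. *)
Lemma same_fiber_line p x t (f : 'rV[R]_n) : 0 < t -> (f <= F x)%MS ->
  ((f + t *: (x - p))%R <= F p)%MS -> same_fiber x p.
Proof.
move=> t0 fx fp; apply: (@same_fiberP x p (x + t^-1 *: f)).
  by rewrite addrC addKr scalemx_sub.
have -> : x + t^-1 *: f - p = t^-1 *: (f + t *: (x - p)).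
  by rewrite scalerDr scalerA mulVf ?gt_eqF // scale1r addrAC addrC.
exact: scalemx_sub.
Qed.

Lemma F_not_full x : exists2 e : 'rV[R]_n, e != 0 & e *m P x = 0.
Proof.
have : 1%:M - P x != 0.
  apply: contraTneq lt_kn => /eqP; rewrite subr_eq0 => /eqP e.
  have := proj_trace (F_free x); rewrite -/(P x) -e mxtrace1 => /eqP.
  by rewrite eqr_nat => /eqP ->; rewrite ltnn.
case/matrix0Pn => i [j ij]; exists (row i (1%:M - P x)).
  by apply/matrix0Pn; exists 0, j; rewrite mxE.
by rewrite -row_mul mulmxBl mul1mx proj_idem ?subrr ?row0.
Qed.

Lemma sub_P x (v : 'rV[R]_n) : (v *m (1%:M - P x) = 0) <-> (v <= F x)%MS.
Proof.
rewrite sub_projE // mulmxBr mulmx1; split=> [/subr0_eq <-//|/eqP ->].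
by rewrite subrr.
Qed.

(* A fiber whose foot is as far as possible from the origin could be pushed
   further out. *)
Lemma foot_unbounded (C : R) : exists x, C < `|a x|.
Proof.
apply: contrapT => /forallNP H; have {}H x : `|a x| <= C by rewrite leNgt; apply/negP/H.
(* The ball of radius [C] contains all feet and each foot lies on its own fiber, so a maximum over
   the ball is one over all fibers. *)
have [p _ maxp] : exists2 p, True & forall x, dot (a x) (a x) <= dot (a p) (a p).
  have cK : compact [set y : 'rV[R]_n | `|y| <= C].
    apply: bounded_closed_compact.
      by exists C; split; rewrite ?num_real // => M CM y /= /le_trans; apply; exact: ltW.
    apply: (@preimage_closed _ _ (fun y : 'rV[R]_n => `|y|) [set t | t <= C]).
      by move=> y _; exact: norm_continuous.
    exact: closed_le.
  have [||p _ maxp] := @EVT_max_rV R n (fun x => dot (a x) (a x)) _ _ cK.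
  - by exists (a 0); exact: H.
  - apply: continuous_subspaceT; under eq_fun do rewrite dotE.
    apply: continuous_sum => i.
    by apply: continuous_mul; apply: continuous_entry; exact: a_continuous.
  exists p => // x; have := maxp (a x) (mem_set (H x)).
  suff -> : a (a x) = a x by [].
  apply/esym/same_fiber_foot/(@same_fiberP _ _ (a x)); last by rewrite subrr sub0mx.
  by rewrite -opprB eqmx_opp foot_sub.
(* A direction orthogonal to the fiber of [p], with the sign for which moving the foot along [e]
   increases its length. *)
have [e [e0 eP ep]] : exists e : 'rV[R]_n, [/\ e != 0, e *m P p = 0 & 0 <= dot e (a p)].
  have [e e0 eP] := F_not_full p; have [ep|ep] := leP 0 (dot e (a p)); first by exists e.
  by exists (- e); rewrite oppr_eq0 mulNmx eP oppr0 dotNl oppr_ge0 ltW.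
pose h (w : R * 'rV[R]_n) := a w.2 - a p - w.1 *: e.
have ch : continuous h.
  apply: continuous_sub; last first.
    by apply: continuous_scale; [exact: continuous_fst|exact: continuous_const].
  apply: continuous_sub; last exact: continuous_const.
  by apply: continuous_compose; [exact: continuous_snd|exact: a_continuous].
have := @hit_stable R n R^o 0 h (P p) p 1 ltr01 ch (proj_idem (F_free p)).
case.
  move=> y t y1 yP t0; rewrite /h /= scale0r subr0 => /sub_P sub.
  suff : same_fiber (p + y) p.
    move=> /same_fiber_perp /(_ yP) y0; move: y1; rewrite y0 normr0 => /eqP.
    by rewrite eq_sym oner_eq0.
  (* Passing from the feet back to [p + y] and [p] adds one more [y], so the factor [1 + t] is
     positive even for [t = 0]. *)
  apply: (@same_fiber_line p (p + y) (1 + t) (a (p + y) - (p + y))).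
  - by rewrite ltr_pwDl.
  - by rewrite -opprB eqmx_opp foot_sub.
  rewrite (_ : p + y - p = y); last by rewrite addrC addKr.
  rewrite scalerDl scale1r.
  have -> : a (p + y) - (p + y) + (y + t *: y) = (a (p + y) - a p + t *: y) + (a p - p).
    by apply/rowP => i; rewrite !mxE; ring.
  by apply: addmx_sub => //; rewrite -opprB eqmx_opp foot_sub.
move=> d /= d0 dP; have [|y _] := dP (d / 2).
  by rewrite /= sub0r normrN gtr0_norm ?divr_gt0 //; rewrite ltr_pdivrMr // mulr_natr; lra.
rewrite /h /=; set s := d / 2 => /sub_P sub.
have s0 : 0 < s by rewrite divr_gt0.
(* The new foot is [a p + s *: e] up to the direction [q] of [F p]. The two parts are orthogonal, so
   it is longer than [a p]. *)
set q := _ - _ - _ in sub.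
have aE : a (p + y) = (a p + s *: e) + q by rewrite /q; apply/rowP => i; rewrite !mxE; ring.
have cq : dot (a p + s *: e) q = 0.
  move: sub; rewrite sub_projE // => /eqP <-; rewrite -[proj _]proj_tr -dot_mulmx -/(P p).
  by rewrite mulmxDl foot_perp -scalemxAl eP scaler0 addr0 /dot mul0mx mxE.
have := maxp (p + y); rewrite aE leNgt => /negP; apply.
clearbody q.
have -> : dot (a p + s *: e + q) (a p + s *: e + q) =
    dot (a p + s *: e) (a p + s *: e) + dot q q.
  by rewrite dotDl !(dotDr _ q) cq (dotC q) cq addr0 add0r.
rewrite dotDl !dotDr !dotZl !dotZr (dotC (a p) e).
have := dot_ge0 q; have := mulr_gt0 (mulr_gt0 s0 s0) (dot_gt0 e0).
have := mulr_ge0 (ltW s0) ep; nra.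
Qed.

(* The fibers near [F p] cover a neighbourhood of the point at infinity [u];
   the pair [(v, s)] stands for the projective point [v / s]. *)
Lemma cover_at_infinity p (u : 'rV[R]_n) : (u <= F p)%MS -> u != 0 ->
  \forall w \near (u, 0 : R), exists x,
    `|a x| <= `|a p| + 1 /\ (w.1 - w.2 *: x <= F x)%MS.
Proof.
move=> up u0.
have : \forall x \near p, `|P p - P x| < n.+1%:R^-1 /\ `|a p - a x| < 1.
  have /cvgrPdist_lt H1 := P_continuous (x := p).
  have /cvgrPdist_lt H2 := a_continuous (x := p).
  by apply: filterI; [apply: H1; rewrite invr_gt0 | apply: H2].
move=> /nbhs_normP[d /= d0 dP]; pose r := d / 2; have r0 : 0 < r by rewrite divr_gt0.
have near_p y : `|y| <= r -> `|P p - P (p + y)| < n.+1%:R^-1 /\ `|a p - a (p + y)| < 1.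
  move=> yr; apply: dP; rewrite /= opprD addrA subrr sub0r normrN.
  by apply: le_lt_trans yr _; rewrite /r; lra.
(* Such a [z] equals [z *m (P p - P (p + y))], whose entries are at most [n / n.+1] times the norm
   of [z]. *)
have graph y (z : 'rV[R]_n) : `|y| <= r -> z *m P p = z -> z *m P (p + y) = 0 -> z = 0.
  move=> /near_p[Py _] zp zy; apply/eqP; rewrite -normr_eq0; apply: contraT => z0.
  have {}z0 : 0 < `|z| by rewrite lt_neqAle eq_sym z0 normr_ge0.
  have : `|z| <= n%:R * (`|z| * n.+1%:R^-1).
    apply/mx_norm_le => [|i j]; first by rewrite !mulr_ge0 // invr_ge0.
    rewrite -[in leLHS](subr0 z) -{1}zp -zy -mulmxBr mxE (ord1 i).
    apply: le_trans (ler_norm_sum _ _ _) _.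
    rewrite mulr_natl -[X in _ *+ X]card_ord -sumr_const; apply: ler_sum => l _.
    rewrite normrM; apply: ler_pM => //; first exact: mx_entry_le.
    by apply: le_trans (ltW Py); exact: mx_entry_le.
  rewrite mulrCA ler_pMr // ler_pdivlMr // mul1r ler_nat ltnn.
  by [].
(* The defect orthogonal to [F x]: for [s] nonzero it vanishes exactly when [v / s] lies on the
   fiber of [x]. *)
pose h (w : ('rV[R]_n * R) * 'rV[R]_n) :=
  (w.1.2 *: w.2 - w.1.1) *m (1%:M - P w.2).
have ch : continuous h.
  have c2 : continuous (fun w : ('rV[R]_n * R) * 'rV[R]_n => w.2) by exact: continuous_snd.
  have c11 : continuous (fun w : ('rV[R]_n * R) * 'rV[R]_n => w.1.1).
    by apply: (@continuous_compose _ _ _ fst fst); exact: continuous_fst.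
  have c12 : continuous (fun w : ('rV[R]_n * R) * 'rV[R]_n => w.1.2).
    by apply: (@continuous_compose _ _ _ fst snd); [exact: continuous_fst|exact: continuous_snd].
  apply: continuous_mulmx; first by apply: continuous_sub => //; exact: continuous_scale.
  apply: continuous_sub; first exact: continuous_const.
  by apply: continuous_compose; [exact: c2|exact: P_continuous].
have := @hit_stable R n _ (u, 0 : R) h (P p) p r r0 ch (proj_idem (F_free p)).
have uP : u *m P p = u by apply/eqP; rewrite -sub_projE.
move=> stable; have {stable} : \forall w \near (u, 0 : R),
    exists2 y, `|y| <= r & h (w, p + y) *m (1%:M - P p) = 0.
  apply: stable => y t yr yP t0 /sub_P.
  rewrite /h /= scale0r sub0r mulmxBr mulmx1 mulNmx opprK; set f := u *m P (p + y) => sub.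
  have fx : (f <= F (p + y))%MS by exact: proj_sub.
  have fp : ((f + t *: y)%R <= F p)%MS.
    have -> : f + t *: y = - u + f + t *: y + u by apply/rowP => i; rewrite !mxE; ring.
    exact: addmx_sub.
  suff same : same_fiber (p + y) p.
    by move: r0; rewrite -yr (same_fiber_perp same yP) normr0 ltxx.
  (* For positive [t] the two fibers meet. For [t = 0] they share the direction [f], so by skewness
     they coincide or [f = 0], and the latter contradicts [graph]. *)
  move: t0; rewrite le_eqVlt => /orP[/eqP t0|t0]; last first.
    by apply: (@same_fiber_line p (p + y) t f) => //; rewrite (addrC p y) addrK.
  apply: contrapT => /skew /(_ f fx); move: fp; rewrite -t0 scale0r addr0 => fp /(_ fp) f0.
  by move/eqP: u0; apply; apply: (graph y); rewrite ?yr.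
apply: filterS => -[v s] [y yr /sub_P]; rewrite /h /= => hp; exists (p + y); split.
  have [_ ] := near_p y yr; have := ler_normB (a p) (a p - a (p + y)).
  by rewrite subKr; lra.
(* [hit_stable] makes the defect vanish only modulo [F p]; being orthogonal to [F (p + y)], it
   vanishes altogether by [graph]. *)
rewrite -opprB eqmx_opp; set z := _ - v in hp *; apply/sub_P; apply: (graph y) => //.
  by apply/eqP; rewrite -sub_projE.
rewrite -mulmxA (_ : _ *m P (p + y) = 0) ?mulmx0 //.
by rewrite mulmxBl mul1mx proj_idem // subrr.
Qed.

(** For nonzero [a x], the orthogonal projector onto the linear span of the fiber through [x]. *)
Let span x : 'M[R]_n := P x + (dot (a x) (a x))^-1 *: ((a x)^T *m a x).

Lemma span_idem x : a x != 0 -> span x *m span x = span x.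
Proof.
move=> ax; rewrite /span mulmxDl !mulmxDr proj_idem // -!scalemxAr -!scalemxAl.
have Pa : P x *m (a x)^T = 0 by rewrite -[P x]proj_tr -trmx_mul foot_perp trmx0.
rewrite mulmxA Pa mul0mx scaler0 addr0 -[in X in _ + X]mulmxA foot_perp mulmx0 scaler0 add0r.
rewrite -mulmxA (mulmxA (a x)) (mx11_scalar (a x *m (a x)^T)) -/(dot _ _).
by rewrite mul_scalar_mx -scalemxAr !scalerA -mulrA mulVf ?mulr1 // gt_eqF // dot_gt0.
Qed.

Lemma span_trace x : a x != 0 -> \tr (span x) = k.+1%:R.
Proof.
move=> ax; rewrite mxtraceD proj_trace // mxtraceZ mxtrace_mulC.
rewrite (mx11_scalar (a x *m (a x)^T)) -/(dot _ _) mxtrace_scalar mulr1n.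
by rewrite mulVf ?gt_eqF ?dot_gt0 // -natr1.
Qed.

Lemma span_tr x : (span x)^T = span x.
Proof. by rewrite /span linearD linearZ /= [X in X + _]proj_tr trmx_mul trmxK. Qed.

(** For a symmetric idempotent, a diagonal entry is the sum of the squares of its row, hence at most
    1, and it bounds the square of each entry of the row. *)
Lemma span_bounded x : a x != 0 -> `|span x| <= 1.
Proof.
move=> ax; apply/mx_norm_le => // i j; set Q := span x.
have Qsym l m : Q m l = Q l m by rewrite /Q -[in RHS]span_tr [RHS]mxE.
have QE l : Q l l = \sum_m Q l m ^+ 2.
  have QQ := span_idem ax; rewrite -/Q in QQ; rewrite -[in LHS]QQ [LHS]mxE; apply: eq_bigr => m _.
  by rewrite expr2 (Qsym l).
have Qle l m : Q l m ^+ 2 <= Q l l.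
  by rewrite QE (bigD1 m) //= lerDl sumr_ge0 // => c _; exact: sqr_ge0.
have Q1 : Q i i <= 1.
  by have := Qle i i; have := sqr_ge0 (Q i i); nra.
rewrite -(ler_pXn2r (ltn0Sn 1)) ?nnegrE // expr1n -normrX ger0_norm ?sqr_ge0 //.
exact: le_trans (Qle i j) Q1.
Qed.

Lemma mul_span x u : u *m span x = u *m P x + (dot u (a x) / dot (a x) (a x)) *: a x.
Proof.
rewrite mulmxDr -scalemxAr (mulmxA u (a x)^T) (mx11_scalar (u *m (a x)^T)) -/(dot _ _).
by rewrite mul_scalar_mx scalerA mulrC.
Qed.

(** Matrices are flattened to row vectors for the Heine-Borel theorem. A cluster point of the spans
    is then again idempotent of trace [k.+1]. *)
Lemma idem_compact : compact [set v : 'rV[R]_(n * n) |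
  [/\ `|v| <= 1, vec_mx v *m vec_mx v = vec_mx v & \tr (vec_mx v) = k.+1%:R]].
Proof.
have cvec : continuous (@vec_mx R n n).
  apply: continuous_mx => i j; under eq_fun do rewrite mxE.
  by move=> v; exact: coord_continuous.
apply: bounded_closed_compact.
  exists 1; split; rewrite ?num_real // => M M1 v [v1 _ _].
  by apply: le_trans v1 _; exact: ltW.
rewrite (_ : mkset _ = (fun v : 'rV[R]_(n * n) => `|v|) @^-1` [set t | t <= 1] `&`
  (fun v : 'rV[R]_(n * n) => `|vec_mx v *m vec_mx v - vec_mx v|) @^-1` [set t | t = 0] `&`
  (fun v : 'rV[R]_(n * n) => \tr (vec_mx v)) @^-1` [set t | t = k.+1%:R]); last first.
  apply/seteqP; split => v /=.
    by case=> v1 e1 e2; rewrite e1 subrr normr0.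
  by case=> -[v1 /normr0_eq0/subr0_eq e1] e2.
apply: closedI; first apply: closedI.
- apply: preimage_closed; last exact: closed_le.
  by move=> v _; exact: norm_continuous.
- apply: preimage_closed; last exact: closed_eq.
  move=> v _; apply: continuous_norm.
  by apply: continuous_sub => //; exact: continuous_mulmx.
- apply: preimage_closed; last exact: closed_eq.
  move=> v _; rewrite /mxtrace; apply: continuous_sum => i.
  exact: continuous_entry.
Qed.

Lemma exists_transverse : exists H : 'M[R]_(k.+1, n),
  row_free H /\ forall x, transverse_dirs H (F x).
Proof.
have [x_ xP] : exists x_ : nat -> 'rV[R]_n, forall j, j%:R < `|a (x_ j)|.
  have [x_ xP] := choice (fun j : nat => foot_unbounded j%:R); by exists x_.
have a0 j : a (x_ j) != 0 by rewrite -normr_gt0; apply: le_lt_trans (xP j).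
have := idem_compact => /(_ ((fun j => mxvec (span (x_ j))) @ \oo) _) [|w [[_ ww wt] wcl]].
  exists 0%N => // j _; rewrite /= mxvecK span_idem ?span_trace //; split=> //.
  apply/mx_norm_le => // i l; rewrite (ord1 i).
  case/mxvec_indexP: l => i' l; rewrite mxvecE.
  by apply: le_trans (span_bounded (a0 j)); exact: mx_entry_le.
have [H [fH HQ]] := idem_basis ww wt.
exists H; split=> // p u uH up; apply/eqP; apply: contraT => u0; exfalso.
have uQ : u *m vec_mx w = u.
  have /submxP[D ->] := submx_trans uH HQ.
  by rewrite -mulmxA ww.
have /nbhs_normP[d /= d0 dP] := cover_at_infinity up u0.
(* The bound [d] allows [cover_at_infinity] to be applied; the bound by the norm of [u] keeps the
   projected vector nonzero. *)
have cl1 : \forall v \near w, `|u - u *m vec_mx v| < Num.min d `|u|.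
  have cu : continuous (fun v : 'rV[R]_(n * n) => u *m vec_mx v).
    apply: continuous_mulmx; first exact: continuous_const.
    apply: continuous_mx => i j; under eq_fun do rewrite mxE.
    by move=> v; exact: coord_continuous.
  have /cvgrPdist_lt := cu w; rewrite uQ; apply.
  by rewrite lt_min d0 normr_gt0.
have ev : \forall j \near \oo, n%:R * `|u| / d < j%:R /\ `|a p| + 1 < j%:R.
  by apply: filterI; exact: nbhs_infty_gtr.
have [_ [[j [jd jp] <-]]] : exists v, (exists2 j : nat,
    (n%:R * `|u| / d < j%:R /\ `|a p| + 1 < j%:R) & mxvec (span (x_ j)) = v) /\
    `|u - u *m vec_mx v| < Num.min d `|u|.
  have [|v [? ?]] := wcl [set v | exists2 j : nat,
    (n%:R * `|u| / d < j%:R /\ `|a p| + 1 < j%:R) & mxvec (span (x_ j)) = v] _ _ cl1.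
    by apply: filterS ev => j ?; exists j.
  by exists v.
rewrite mxvecK lt_min => /andP[ud un].
set v := u *m span (x_ j) in ud un.
(* The vector [v] is [s *: a (x_ j)] plus a direction of the far fiber, so this fiber passes through
   the projective point [v / s]; [s] is small because the foot is far away. *)
pose s := dot u (a (x_ j)) / dot (a (x_ j)) (a (x_ j)).
have v0 : v != 0 by apply: contraTneq un => ->; rewrite subr0 ltxx.
have vsub : (v - s *: x_ j <= F (x_ j))%MS.
  rewrite -(subrK (s *: a (x_ j)) v) -addrA -scalerBr addmx_sub //.
    by rewrite /v mul_span addrK; exact: proj_sub.
  by rewrite scalemx_sub // -opprB eqmx_opp foot_sub.
have sd : `|s| < d.
  have aj0 : 0 < `|a (x_ j)| by rewrite normr_gt0.
  rewrite /s normrM normfV (ger0_norm (dot_ge0 _)) ltr_pdivrMr ?dot_gt0 //.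
  apply: le_lt_trans (norm_dot_le _ _) _.
  apply: (@lt_le_trans _ _ (d * `|a (x_ j)| ^+ 2)); last by rewrite ler_pM2l // norm_sqr_le_dot.
  rewrite expr2 !mulrA ltr_pM2r // [d * _]mulrC -ltr_pdivrMr //.
  exact: lt_trans jd (xP j).
have [x [ax vx]] : exists x, `|a x| <= `|a p| + 1 /\ (v - s *: x <= F x)%MS.
  by apply: (dP (v, s)); rewrite /= prod_normE /= sub0r normrN gt_max ud.
suff /same_fiber_foot ae : same_fiber x (x_ j).
  by have := xP j; rewrite -ae; lra.
(* The two fibers share the direction [v] if [s = 0], and the point [v / s] otherwise. *)
have [s0|s0] := eqVneq s 0.
  move: vx vsub; rewrite s0 !scale0r subr0 => vx vj.
  by apply: contrapT => /skew /(_ v vx vj) /eqP; apply/negP.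
have scaled z : s^-1 *: v - z = s^-1 *: (v - s *: z).
  by rewrite scalerBr scalerA mulVf // scale1r.
apply: (@same_fiberP _ _ (s^-1 *: v)); rewrite scaled.
  exact: (scalemx_sub _ vx).
exact: (scalemx_sub _ vsub).
Qed.

End Fibration.

Theorem theorem1p3 (R : realType) (k n : nat) (lt_kn : (k < n)%N)
    (a : 'rV[R]_n -> 'rV[R]_n) (F : 'rV[R]_n -> 'M[R]_(k, n)) :
  oriented_affine_fibration a F ->
  skew_fibration a F ->
  exists (b : 'rV[R]_n) (H : 'M[R]_(k.+1, n)),
    row_free H /\ forall x, transverse_dirs H (F x).
Proof.
(* Transversality concerns directions only, so the plane may pass through any point. *)
move=> fib skew; exists 0.
exact: (exists_transverse lt_kn fib skew).
Qed.
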